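(* Let $S[L,\mathfrak m]$ be a Krein string with principal Titchmarsh–Weyl coefficient $q_S$, and set $$\delta(t):=\Bigl(\int_{[0,t)}\xi^2\,d\mathfrak m(\xi)\Bigr)\cdot\Bigl(\int_{[0,t)}d\mathfrak m(\xi)\Bigr)-\Bigl(\int_{[0,t)}\xi\,d\mathfrak m(\xi)\Bigr)^2,\qquad t\in[0,L).$$ Let $$\hat\tau(r):=\inf\bigl\{t>0:\ \tfrac1{r^2}\le\delta(t)\bigr\},\qquad r\in(0,\infty).$$ Set $$f(r):=\mathfrak m([0,\hat\tau(r)))+\mathfrak m(\{\hat\tau(r)\})\,\frac{\frac1{r^2}-\delta(\hat\tau(r))}{\delta(\hat\tau(r)+)-\delta(\hat\tau(r))}$$ if $\delta$ is discontinuous at $\hat\tau(r)$, and $f(r):=\mathfrak m([0,\hat\tau(r)))$ otherwise. Then $$\operatorname{Im}q_S(ir)\asymp\frac1{r\,f(r)},\qquad r\in(0,\infty),$$ with constants independent of the string.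
   Context: A Krein string $S[L,\mathfrak m]$ is a pair consisting of a number $L\in(0,\infty]$ and a nonnegative Borel measure $\mathfrak m$ on $[0,L]$ such that $\mathfrak m([0,t])$ is finite for every $t\in[0,L)$ and $\mathfrak m(\{L\})=0$. The associated equation is $y_+'(x)+z\int_{[0,x]}y(t)\,d\mathfrak m(t)=0$, $x\in[0,L)$, where $y_+'$ is the right-hand derivative of $y$ and $z\in\mathbb C$ is a spectral parameter. Principal Titchmarsh–Weyl coefficient: let $\varphi(\cdot,z),\psi(\cdot,z)$ be the solutions on $[0,L)$ of $$\varphi(x,z)=1-z\int_{[0,x]}(x-t)\varphi(t,z)\,d\mathfrak m(t),\qquad \psi(x,z)=x-z\int_{[0,x]}(x-t)\psi(t,z)\,d\mathfrak m(t).$$ Then $q_S(z):=\lim_{x\to L}\frac{\psi(x,z)}{\varphi(x,z)}$ for $z\in\mathbb C\setminus[0,\infty)$. $\delta(t+)$ denotes the right-hand limit of $\delta$ at $t$. $f\asymp g$ means $C_1g\le f\le C_2g$ with constants $C_1,C_2>0$ on the indicated range.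
   Formalization: The measure is assumed nonzero (otherwise f(r)=0), and the lower estimate is claimed only if L is infinite or some t in (0,L) has δ(t) ≥ 1/r²; for finite L and r below that range it fails (e.g. a point mass at 0, r→0). The upper estimate is kept for all r. *)

(* Defs.v *)
From HB Require Import structures.
From mathcomp Require Import all_boot all_order all_algebra.
From mathcomp Require Import all_classical all_reals all_analysis.
From mathcomp.real_closed Require Export complex.

Set Implicit Arguments.
Unset Strict Implicit.
Unset Printing Implicit Defensive.

Import Order.TTheory GRing.Theory Num.Theory.
Import numFieldNormedType.Exports.

Local Open Scope classical_set_scope.
Local Open Scope ring_scope.
Local Open Scope complex_scope.

(* A Borel measure on [0, L] without mass at L is the same thing as a Borel
   measure on the real line that vanishes outside [0, L); this encoding avoids
   the point at infinity when L = +oo. *)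
Record krein_string (R : realType) := KreinString {
  slen : \bar R ;
  smass : {measure set (measurableTypeR R) -> \bar R} ;
  slen_gt0 : (0 < slen)%E ;
  smass_supp : smass [set x : R | ~ (0 <= x /\ (x%:E < slen)%E)] = 0%E ;
  smass_fin : forall t : R, 0 <= t -> (t%:E < slen)%E ->
    (smass `[0%R, t]%classic < +oo)%E }.

Section KreinString.
Variables (R : realType) (S : krein_string R).
Let L := slen S.
Let m := smass S.

Definition cintegrable (D : set R) (g : R -> R[i]) : Prop :=
  m.-integrable D (fun t => (complex.Re (g t))%:E) /\
  m.-integrable D (fun t => (complex.Im (g t))%:E).

Definition cintegral (D : set R) (g : R -> R[i]) : R[i] :=
  (\int[m]_(t in D) complex.Re (g t)) +i* (\int[m]_(t in D) complex.Im (g t)).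

(* y solves y(x) = a(x) - z \int_[0,x] (x - t) y(t) dm(t) on [0, L).  Local
   integrability makes the right-hand side meaningful, as the library integral
   of a non-integrable function is a default value. *)
Definition string_solution (a : R -> R) (z : R[i]) (y : R -> R[i]) : Prop :=
  forall x : R, 0 <= x -> (x%:E < L)%E ->
    cintegrable `[0, x]%classic y /\
    y x = (a x)%:C
          - z * cintegral `[0, x]%classic (fun t => (x - t)%:C * y t).

Definition fundamental_solutions (phi psi : R -> R[i] -> R[i]) : Prop :=
  forall z : R[i], string_solution (fun=> 1) z (phi^~ z) /\
                   string_solution id z (psi^~ z).

(* The filter of x tending to L from within [0, L); L = -oo does not occur. *)
Definition string_end : set_system R :=
  match L with
  | l%:E => l^'-
  | +oo%E => +oo
  | -oo%E => -oo
  end.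

Definition qS (phi psi : R -> R[i] -> R[i]) (z : R[i]) : R[i] :=
  lim ((psi x z / phi x z : R[i]^o) @[x --> string_end]).

Definition delta (t : R) : R :=
  (\int[m]_(xi in `[0, t[) xi ^+ 2) * (\int[m]_(xi in `[0, t[) 1)
  - (\int[m]_(xi in `[0, t[) xi) ^+ 2.

Definition tau_set (r : R) : set R :=
  [set t | [/\ 0 < t, (t%:E < L)%E & 1 / r ^+ 2 <= delta t]].

(* Equal to +oo if tau_set r is empty; then f_hat r is the total mass. *)
Definition tau_hat (r : R) : \bar R := ereal_inf (EFin @` tau_set r).

Definition delta_right (t : R) : R := lim (delta s @[s --> t^'+]).

Definition f_hat (r : R) : R :=
  match tau_hat r with
  | t%:E =>
      if pselect (delta s @[s --> t] --> delta t) then fine (m `[0, t[%classic)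
      else fine (m `[0, t[%classic)
           + fine (m [set t]) * ((1 / r ^+ 2 - delta t)
                                 / (delta_right t - delta t))
  | _ => fine (m `[0, +oo[%classic)
  end.

End KreinString.

(* Main.v *)
Require Import Defs.
From mathcomp Require Import all_boot all_order all_algebra.
From mathcomp Require Import all_classical all_reals all_analysis.
From mathcomp Require Import measurable_realfun.
From mathcomp Require Import ring lra.

(** Put [z = i r] and let [q_X = psi(X) / phi(X)] be the coefficient of the string cut
    at [X] with a Dirichlet condition there. The solution [y = q_X phi - psi] vanishes
    at [X], has slope [-1] at the left end, and satisfies [Im q_X = r * |y|^2] in
    [L^2(m)] ([dirichlet_energy]). Two estimates of [Im q_X], with constants that
    depend on nothing, give the theorem in the limit.

    Both compare the string with the measure [mu] consisting of the mass on
    [[0, t[] and a fraction of the mass at [t], where [t = tau_hat r]. The determinant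
    [delta] is affine in a point mass at the right end, so the interpolation in the
    definition of [f_hat] says exactly that [mu] has total mass [f_hat r] and
    determinant [1 / r^2] ([f_hat_cut_weight]). Moreover [2 delta(mu)] is the double
    integral of [(x - t)^2] against [mu] in both variables.

    Upper bound ([dirichlet_upper]). The imaginary part [b] of [y] is [Im q_X] minus
    [r] times the integral of [(x - t)] against the real part [a]. By Cauchy-Schwarz
    and [delta(mu) <= 1 / r^2] the distance of [b] from the constant [Im q_X] in
    [L^2(mu)] is at most [sqrt 2] times the norm of [a], whence
    [(Im q_X)^2 f <= 4 |y|^2 = 4 Im q_X / r].

    Lower bound ([dirichlet_lower_truncated]). Green's identity and Cauchy-Schwarz give
    [1 <= Im q_X * (r |u|^2 + |g|^2 / r)] for every [u] with [u(0) = 1], slope [0] at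
    the left end, and [u(X) = 0], where [g] is the image of [u] under the Krein-Feller
    operator. A function [u] that decreases from [1] to [0] on [[0, t]] and whose
    [g] is affine there has [|u|^2 <= f] and [|g|^2 <= f / delta(mu) = r^2 f], whence
    [1 <= Im q_X * 2 r f].

    It remains to prove that [q_X] converges ([weyl_cvg]). It is bounded, and
    [|q_Y - q_X|^2 * |phi|^2], with the norm of [phi] over [[0, X]], is bounded too, which
    suffices if [phi] is not square integrable. If it is, then the total mass is finite,
    since [|phi(X)|] dominates the root mean square of [phi] over [[0, X]]; the solutions
    or their slopes then converge at the end of the string. Complex functions are
    replaced by pairs of real ones throughout. *)

Set Implicit Arguments.
Unset Strict Implicit.
Unset Printing Implicit Defensive.

Import Order.TTheory GRing.Theory Num.Theory.
Import numFieldNormedType.Exports.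
Local Open Scope classical_set_scope.
Local Open Scope ring_scope.
Local Open Scope complex_scope.

(** * Bounded measurable functions on a set of finite measure *)

Section BoundedMeasurable.
Context d (T : measurableType d) (R : realType).
Variables (mu : {measure set T -> \bar R}) (D : set T).
Hypotheses (mD : measurable D) (finD : (mu D < +oo)%E).

(** Boundedness makes every function integrable on [D], so that the integral
    becomes a linear monotone functional on an algebra of functions. Nothing is
    required outside [D]: solutions of the string equation are arbitrary beyond
    the end of the string. *)
Definition bmfun (f : T -> R) : Prop :=
  measurable_fun D f /\ exists M, forall x, D x -> `|f x| <= M.

Lemma bmfun_cst c : bmfun (fun=> c).
Proof. by split; [exact: measurable_cst|exists `|c|]. Qed.

Lemma bmfunD f g : bmfun f -> bmfun g -> bmfun (fun x => f x + g x).
Proof.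
move=> [mf [M hM]] [mg [N hN]]; split; first exact: measurable_funD.
exists (M + N) => x Dx; apply: le_trans (ler_normD _ _) _.
by apply: lerD; [exact: hM|exact: hN].
Qed.

Lemma bmfunM f g : bmfun f -> bmfun g -> bmfun (fun x => f x * g x).
Proof.
move=> [mf [M hM]] [mg [N hN]]; split; first exact: measurable_funM.
by exists (M * N) => x Dx; rewrite normrM ler_pM ?hM ?hN.
Qed.

Lemma bmfunN f : bmfun f -> bmfun (fun x => - f x).
Proof.
move=> [mf [M hM]]; split; first exact: measurable_funN.
by exists M => x Dx; rewrite normrN hM.
Qed.

Lemma bmfunB f g : bmfun f -> bmfun g -> bmfun (fun x => f x - g x).
Proof. by move=> hf hg; apply: bmfunD => //; exact: bmfunN. Qed.

Lemma bmfunX f n : bmfun f -> bmfun (fun x => f x ^+ n).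
Proof.
move=> hf; elim: n => [|n IH].
  by under eq_fun do rewrite expr0; exact: bmfun_cst.
by under eq_fun do rewrite exprS; exact: bmfunM.
Qed.

Lemma bmfun_norm f : bmfun f -> bmfun (fun x => `|f x|).
Proof.
move=> [mf [M hM]]; split; first exact: measurableT_comp.
by exists M => x Dx; rewrite normr_id hM.
Qed.

Lemma bmfun_ext f g : {in D, f =1 g} -> bmfun f -> bmfun g.
Proof.
move=> fg [mf [M hM]]; split; first exact: eq_measurable_fun mf.
by exists M => x Dx; rewrite -fg ?inE// hM.
Qed.

Lemma bmfun_bool (b : T -> bool) : measurable_fun D b ->
  bmfun (fun x => (b x)%:R).
Proof.
move=> mb; split.
  apply: (eq_measurable_fun (fun x => if b x then 1%R else 0%R : R)).
    by move=> x _; case: (b x).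
  by move=> mD'; move: (mD'); apply: measurable_fun_if.
by exists 1 => x _; case: (b x); rewrite ?normr1 ?normr0.
Qed.

Lemma bmfun_integrable f : bmfun f -> mu.-integrable D (EFin \o f).
Proof.
move=> [mf [M hM]]; apply: measurable_bounded_integrable => //.
by exists M; split; [exact: num_real|move=> x Mx t Dt; apply: le_trans (hM _ Dt) (ltW Mx)].
Qed.

Local Notation J f := (\int[mu]_(x in D) f x).

Lemma bmintD f g : bmfun f -> bmfun g ->
  \int[mu]_(x in D) (f x + g x) = J f + J g.
Proof. by move=> hf hg; apply: RintegralD => //; exact: bmfun_integrable. Qed.

Lemma bmintB f g : bmfun f -> bmfun g ->
  \int[mu]_(x in D) (f x - g x) = J f - J g.
Proof. by move=> hf hg; apply: RintegralB => //; exact: bmfun_integrable. Qed.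

Lemma bmintZ c f : bmfun f -> \int[mu]_(x in D) (c * f x) = c * J f.
Proof. by move=> hf; apply: RintegralZl => //; exact: bmfun_integrable. Qed.

Lemma bmint_le f g : bmfun f -> bmfun g -> (forall x, D x -> f x <= g x) ->
  J f <= J g.
Proof. by move=> hf hg fg; apply: le_Rintegral => //; exact: bmfun_integrable. Qed.

(** Extending [F] by zero and restricting [mu] to [D] gives a bounded function
    on a product of finite measure spaces, where Fubini applies; the
    measurability of the inner integral comes out of the same argument. *)
Lemma bmint_fubini (F : T -> T -> R) :
  measurable_fun (D `*` D) (fun p => F p.1 p.2) ->
  (exists M, forall x y, D x -> D y -> `|F x y| <= M) ->
  bmfun (fun x => \int[mu]_(y in D) F x y) /\
  \int[mu]_(x in D) \int[mu]_(y in D) F x y =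
  \int[mu]_(y in D) \int[mu]_(x in D) F x y.
Proof.
move=> mF [M hM].
pose nu : {finite_measure set T -> \bar R} := mfrestr mD finD.
pose G := (fun p : T * T => F p.1 p.2) \_ (D `*` D).
have nuE (f : T -> \bar R) : (\int[mu]_(x in D) f x = \int[nu]_x (f \_ D) x)%E.
  rewrite -[RHS]integral_mkcond.
  apply: eq_measure_integral => A mA AD.
  by rewrite /nu /= /mfrestr /mrestr setIidl.
have mDD : measurable (D `*` D) by exact: measurableX.
have mG : measurable_fun setT G by apply/(measurable_restrictT _ mDD).
have intG : ((nu \x nu)%E).-integrable setT (EFin \o G).
  apply/integrable12ltyP; first exact/measurable_EFinP.
  apply: (@le_lt_trans _ _ (\int[nu]_x \int[nu]_y (`|M|%:E))%E).
    apply: ge0_le_integral => //.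
    - by move=> x _; apply: integral_ge0.
    - apply: (measurable_fun_fubini_tonelli_F (m2 := nu) (abse \o (EFin \o G))) => //.
        by apply: measurableT_comp => //; exact/measurable_EFinP.
      by move=> p; exact: abse_ge0.
    - move=> x _; apply: ge0_le_integral => //.
      + apply: measurableT_comp => //; apply/measurable_EFinP.
        by apply: measurableT_comp => //; exact: pair1_measurable.
      + move=> y _ /=; rewrite lee_fin /G patchE.
        case: ifPn => [|_]; last by rewrite normr0.
        by rewrite inE => -[/= Dx Dy]; apply: le_trans (hM _ _ Dx Dy) (ler_norm _).
  under eq_integral do rewrite integral_cst//.
  rewrite integral_cst// -ge0_fin_numE; last by rewrite !mule_ge0.
  by rewrite !fin_numM// fin_num_measure.
have intGx x : mu.-integrable D (EFin \o (fun y => F x y)) \/ ~ D x.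
  have [Dx|] := pselect (D x); [left|by right].
  apply: bmfun_integrable; split; last by exists M => y; exact: hM.
  apply/(measurable_restrictT _ mD) => //.
  apply: (eq_measurable_fun (fun y => G (x, y))).
    move=> y _; rewrite /G !patchE /=; case: ifPn; case: ifPn => //.
      by rewrite notin_setE => nDy; rewrite inE => -[].
    by rewrite inE notin_setE => Dy []; split.
  by apply: measurableT_comp => //; exact: pair1_measurable.
have intGy y : mu.-integrable D (EFin \o (fun x => F x y)) \/ ~ D y.
  have [Dy|] := pselect (D y); [left|by right].
  apply: bmfun_integrable; split; last by exists M => x Dx; exact: hM.
  apply/(measurable_restrictT _ mD) => //.
  apply: (eq_measurable_fun (fun x => G (x, y))).
    move=> x _; rewrite /G !patchE /=; case: ifPn; case: ifPn => //.
      by rewrite notin_setE => nDx; rewrite inE => -[].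
    by rewrite inE notin_setE => Dx []; split.
  by apply: measurableT_comp => //; exact: pair2_measurable.
have GxE x : (\int[nu]_y (EFin \o G) (x, y) =
    ((fun x => (\int[mu]_(y in D) F x y)%:E) \_ D) x)%E.
  rewrite patchE; case: ifPn; rewrite ?inE ?notin_setE => Dx.
    case: (intGx x) => // iG; rewrite fineK ?integrable_fin_num//.
    rewrite nuE; apply: eq_integral => y _ /=; rewrite /G !patchE.
    case: ifPn; case: ifPn => //; first by rewrite notin_setE => nDy; rewrite inE => -[].
    by rewrite inE notin_setE => Dy []; split.
  rewrite (eq_integral (cst 0%E)) ?integral0// => y _ /=.
  by rewrite /G patchE memNset// => -[].
have GyE y : (\int[nu]_x (EFin \o G) (x, y) =
    ((fun y => (\int[mu]_(x in D) F x y)%:E) \_ D) y)%E.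
  rewrite patchE; case: ifPn; rewrite ?inE ?notin_setE => Dy.
    case: (intGy y) => // iG; rewrite fineK ?integrable_fin_num//.
    rewrite nuE; apply: eq_integral => x _ /=; rewrite /G !patchE.
    case: ifPn; case: ifPn => //; first by rewrite notin_setE => nDy; rewrite inE => -[].
    by rewrite inE notin_setE => Dx []; split.
  rewrite (eq_integral (cst 0%E)) ?integral0// => x _ /=.
  by rewrite /G patchE memNset// => -[].
split.
  split.
    apply/measurable_EFinP/(measurable_restrictT _ mD) => //.
    have := measurable_fubini_F intG; rewrite /fubini_F.
    by under eq_fun do rewrite GxE.
  exists (M * fine (mu D)) => x Dx.
  case: (intGx x) => // iG.
  apply: le_trans (le_normr_Rintegral _ _) _ => //.
  rewrite -Rintegral_cst//; apply: le_Rintegral => //.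
  - exact: integrable_norm.
  - by apply: bmfun_integrable; exact: bmfun_cst.
  - by move=> y Dy; exact: hM.
have := Fubini intG.
under eq_integral do rewrite GxE.
rewrite -nuE => E; congr fine; rewrite [LHS]E nuE.
by apply: eq_integral => y _; exact: GyE.
Qed.

End BoundedMeasurable.

(** * Quadratic estimates *)

(** The discriminant of a quadratic polynomial in [s] without sign change is
    nonpositive; when [C = 0] the polynomial is affine, hence constant. *)
Lemma sqr_le_mul_of_quad_ge0 (R : realFieldType) (A B C : R) : 0 <= C ->
  (forall s, 0 <= A - 2 * s * B + s ^+ 2 * C) -> B ^+ 2 <= A * C.
Proof.
rewrite le_eqVlt => /predU1P[<-|C0] h.
  rewrite mulr0; have [->|B0] := eqVneq B 0; first by rewrite expr0n.
  have := h ((A + 1) / (2 * B)).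
  rewrite (_ : A - _ + _ = - 1) ?oppr_ge0 ?ler10//.
  by field; rewrite B0.
have := h (B / C); rewrite (_ : A - _ + _ = (A * C - B ^+ 2) / C); last first.
  by field; rewrite lt0r_neq0.
by rewrite pmulr_lge0 ?invr_gt0// subr_ge0.
Qed.

Lemma normr_le_of_sqr_le (R : realDomainType) (d e : R) : 0 <= e ->
  d ^+ 2 <= e ^+ 2 -> `|d| <= e.
Proof.
by move=> e0 de; rewrite -(ler_sqr (_ : _ \is Num.nneg)) ?nnegrE// real_normK ?num_real.
Qed.

(* Reduces boundedness and measurability of an algebraic expression to its atoms. *)
Ltac bmt := repeat first
  [ assumption | apply: bmfun_cst | apply: bmfunD | apply: bmfunB
  | apply: bmfunM | apply: bmfunN | apply: bmfunX ].

Ltac bmside := match goal with |- bmfun _ _ => by bmt | _ => assumption end.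

Section CauchySchwarz.
Context d (T : measurableType d) (R : realType).
Variables (mu : {measure set T -> \bar R}) (D : set T).
Hypotheses (mD : measurable D) (finD : (mu D < +oo)%E).
Local Notation J f := (\int[mu]_(t in D) f t).

(** Real and imaginary parts of a solution are only controlled together, so the
    Cauchy-Schwarz inequality is needed for pairs of functions. *)
Lemma bmint_CS2 (f1 f2 g1 g2 : T -> R) :
  bmfun D f1 -> bmfun D f2 -> bmfun D g1 -> bmfun D g2 ->
  (J (fun t => f1 t * g1 t) + J (fun t => f2 t * g2 t)) ^+ 2 <=
  (J (fun t => f1 t ^+ 2) + J (fun t => f2 t ^+ 2)) *
  (J (fun t => g1 t ^+ 2) + J (fun t => g2 t ^+ 2)).
Proof.
move=> hf1 hf2 hg1 hg2; apply: sqr_le_mul_of_quad_ge0 => [|s].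
  by apply: addr_ge0; apply: Rintegral_ge0 => t _; exact: sqr_ge0.
rewrite (_ : _ - _ + _ = J (fun t => (f1 t - s * g1 t) ^+ 2 + (f2 t - s * g2 t) ^+ 2)).
  by apply: Rintegral_ge0 => t _; rewrite addr_ge0 ?sqr_ge0.
rewrite [RHS](@eq_Rintegral _ _ _ _ _ (fun t =>
   (f1 t ^+ 2 - (2 * s) * (f1 t * g1 t) + s ^+ 2 * g1 t ^+ 2)
 + (f2 t ^+ 2 - (2 * s) * (f2 t * g2 t) + s ^+ 2 * g2 t ^+ 2))); last first.
  by move=> t _ /=; ring.
rewrite bmintD; [|bmside..].
rewrite bmintD; [|bmside..]; rewrite bmintB; [|bmside..].
rewrite bmintD; [|bmside..]; rewrite bmintB; [|bmside..].
rewrite !bmintZ; [|bmside..].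
ring.
Qed.

Lemma bmint_CS (f g : T -> R) : bmfun D f -> bmfun D g ->
  J (fun t => f t * g t) ^+ 2 <= J (fun t => f t ^+ 2) * J (fun t => g t ^+ 2).
Proof.
move=> hf hg; have h0 : bmfun D (fun=> 0 : R) by bmt.
have /= := bmint_CS2 hf h0 hg h0.
rewrite (_ : J (fun t => 0 * 0) = 0); last by rewrite mul0r Rintegral_cst// mul0r.
by rewrite !addr0.
Qed.

End CauchySchwarz.

(** * The Green kernel of an interval *)

Section SystemOnInterval.
Variables (R : realType) (m : {measure set (measurableTypeR R) -> \bar R}) (X : R).
Let D : set (measurableTypeR R) := `[0, X]%classic.
Hypotheses (X0 : 0 <= X) (finD : (m D < +oo)%E).
Local Notation J f := (\int[m]_(t in D) f t).

Let mD : measurable D. Proof. exact: measurable_itv. Qed.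

Let DE t : D t <-> 0 <= t <= X.
Proof. by rewrite /D /= in_itv. Qed.

Lemma bmfun_id : bmfun D id.
Proof.
split; first exact: measurable_id.
by exists X => x /DE/andP[x0 xX]; rewrite ger0_norm.
Qed.

Lemma bmfun_max c : bmfun D (fun t => Num.max c t).
Proof.
split; first by apply: measurable_maxr => //; exact: measurable_cst.
exists (`|c| + X) => x /DE/andP[x0 xX].
by case: (leP c x) => _; [rewrite ger0_norm// ler_wpDl|rewrite lerDl].
Qed.

(** The positive part of [x - t], written with [Num.max] so that the difference
    of two ramps exposes the symmetric kernel of [green]. *)
Definition ramp (x t : R) := Num.max x t - t.

Lemma ramp_ge0 x t : 0 <= ramp x t.
Proof. by rewrite subr_ge0 le_max lexx orbT. Qed.

Lemma rampX t : D t -> ramp X t = X - t.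
Proof. by move=> /DE/andP[_ tX]; rewrite /ramp max_l. Qed.

Lemma bmfun_ramp x : bmfun D (ramp x).
Proof. by apply: bmfunB; [exact: bmfun_max|exact: bmfun_id]. Qed.

(** The Green operator of the Krein-Feller operator [- d^2 / dm dx] on [[0, X]],
    with a Neumann condition at [0] and a Dirichlet condition at [X]. *)
Definition green (f : R -> R) (x : R) := J (fun t => (X - Num.max x t) * f t).

Let bmfun_green_int (f : R -> R) (x : R) : bmfun D f -> bmfun D (fun t => (X - Num.max x t) * f t).
Proof. by move=> hf; bmt; exact: bmfun_max. Qed.

(** The kernel is symmetric in [x] and [t], hence the Green operator is
    self-adjoint. This replaces integration by parts, and with it any use of the
    derivatives of solutions. *)
Lemma green_symm (f g : R -> R) : bmfun D f -> bmfun D g ->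
  bmfun D (green g) /\
  J (fun x => f x * green g x) = J (fun x => g x * green f x).
Proof.
move=> hf hg; have [mf [M hM]] := hf; have [mg [N hN]] := hg.
have mk : measurable_fun (D `*` D)
    (fun p : measurableTypeR R * measurableTypeR R => X - Num.max p.1 p.2).
  apply: measurable_funB; first exact: measurable_cst.
  by apply: measurable_maxr; apply: measurable_funTS; [exact: measurable_fst|exact: measurable_snd].
have hk x t : D x -> D t -> `|X - Num.max x t| <= X.
  move=> /DE/andP[x0 xX] /DE/andP[t0 tX].
  rewrite ger0_norm; first by rewrite gerBl le_max x0.
  by rewrite subr_ge0 ge_max xX tX.
have mfst : measurable_fun (D `*` D)
    (fun p : measurableTypeR R * measurableTypeR R => f p.1).
  apply: (measurable_comp (F := D)) => //; first by move=> _ [[x y] [Dx Dy] <-].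
  by apply: measurable_funTS; exact: measurable_fst.
have msnd : measurable_fun (D `*` D)
    (fun p : measurableTypeR R * measurableTypeR R => g p.2).
  apply: (measurable_comp (F := D)) => //; first by move=> _ [[x y] [Dx Dy] <-].
  by apply: measurable_funTS; exact: measurable_snd.
have [||hG _] := @bmint_fubini _ _ _ m D mD finD
  (fun x t : R => (X - Num.max x t) * g t).
- exact: measurable_funM.
- by exists (X * N) => x t Dx Dt; rewrite normrM ler_pM ?hk ?hN.
split; first exact: hG.
have [||_ E] := @bmint_fubini _ _ _ m D mD finD
  (fun x t : R => f x * ((X - Num.max x t) * g t)).
- by apply: measurable_funM => //; exact: measurable_funM.
- exists (M * (X * N)) => x t Dx Dt.
  by rewrite !normrM ler_pM ?mulr_ge0 ?ler_pM ?hM ?hN ?hk.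
transitivity (J (fun x => J (fun t => f x * ((X - Num.max x t) * g t)))).
  apply: eq_Rintegral => x _.
  by rewrite bmintZ; [reflexivity|exact: mD|exact: finD|exact: bmfun_green_int].
rewrite E; apply: eq_Rintegral => t _.
rewrite -bmintZ; [|exact: mD|exact: finD|exact: bmfun_green_int].
by apply: eq_Rintegral => x _ /=; rewrite maxC; ring.
Qed.

End SystemOnInterval.

(** * Energy identities for the string system *)

(** Real and imaginary parts of a function [y = a + i b] such that
    [y(x) = alpha + i gamma + beta x - z * integral of (x - t) y(t) over [0, x]]
    with [z = i r]. Every integral runs over [[0, X]], the ramp cutting it off
    at [x]: all functions then live on one set of finite measure. *)
Definition string_system (R : realType) (m : {measure set (measurableTypeR R) -> \bar R})
    (X r alpha beta gamma : R) (a b : R -> R) : Prop :=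
  [/\ bmfun (`[0, X]%classic : set (measurableTypeR R)) a,
      bmfun (`[0, X]%classic : set (measurableTypeR R)) b &
      forall x, 0 <= x <= X ->
        a x = alpha + beta * x + r * \int[m]_(t in `[0, X]) (ramp x t * b t) /\
        b x = gamma - r * \int[m]_(t in `[0, X]) (ramp x t * a t)].

Section SystemEstimates.
Variables (R : realType) (m : {measure set (measurableTypeR R) -> \bar R}) (X : R).
Let D : set (measurableTypeR R) := `[0, X]%classic.
Hypotheses (X0 : 0 <= X) (finD : (m D < +oo)%E).
Local Notation J f := (\int[m]_(t in D) f t).
Local Notation K := (green m X).

Let mD : measurable D. Proof. exact: measurable_itv. Qed.

Let DE t : D t <-> 0 <= t <= X.
Proof. by rewrite /D /= in_itv. Qed.

Let DX : D X. Proof. by apply/DE; rewrite X0 lexx. Qed.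

Let bmid : bmfun D (fun t => t). Proof. exact: bmfun_id. Qed.
Let bmramp x : bmfun D (ramp x). Proof. exact: bmfun_ramp. Qed.
Let bmmax c : bmfun D (fun t => Num.max c t). Proof. exact: bmfun_max. Qed.
Let bmK f : bmfun D f -> bmfun D (K f).
Proof. by move=> hf; have [] := green_symm X0 finD hf hf. Qed.

Ltac bmts := bmt; try first [exact: bmid | exact: bmramp | exact: bmmax | by apply: bmK].
Ltac bmsides := match goal with |- bmfun _ _ => by bmts | _ => assumption end.

Lemma green_ramp f x : bmfun D f ->
  K f x = J (fun t => ramp X t * f t) - J (fun t => ramp x t * f t).
Proof.
move=> hf; rewrite -bmintB; [|bmsides..].
apply: eq_Rintegral => t; rewrite inE => Dt.
by rewrite rampX// /ramp; ring.
Qed.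

Section Solution.
Variables (r alpha beta gamma : R) (a b : R -> R).
Hypothesis sol : string_system m X r alpha beta gamma a b.

Let hb : bmfun D b. Proof. by case: sol. Qed.
Let ha : bmfun D a. Proof. by case: sol. Qed.

(** Subtracting the equation at [X] turns the Volterra equation with data at [0]
    into an integral equation with data at [X] and a symmetric kernel. *)
Lemma system_green x : D x ->
  a x = a X - beta * (X - x) - r * K b x /\ b x = b X + r * K a x.
Proof.
case: sol => _ _ h Dx; have [-> ->] := h _ ((DE _).1 Dx).
have [-> ->] := h _ ((DE _).1 DX).
by rewrite !green_ramp//; split; ring.
Qed.

(** Integrate [y] against its conjugate: as the Green operator is self-adjoint,
    its contributions to the two components cancel and only boundary terms are
    left. *)
Lemma system_energy :
  J (fun t => a t ^+ 2) + J (fun t => b t ^+ 2) =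
  a X * J a + b X * J b - beta * J (fun t => (X - t) * a t).
Proof.
have Ea : J (fun t => a t ^+ 2) = a X * J a - beta * J (fun t => (X - t) * a t)
    - r * J (fun t => a t * K b t).
  rewrite -!bmintZ; [|bmsides..].
  rewrite -bmintB; [|bmsides..]; rewrite -bmintB; [|bmsides..].
  apply: eq_Rintegral => t; rewrite inE => /system_green[at_ _].
  by rewrite expr2 {2}at_; ring.
have Eb : J (fun t => b t ^+ 2) = b X * J b + r * J (fun t => b t * K a t).
  rewrite -!bmintZ; [|bmsides..].
  rewrite -bmintD; [|bmsides..].
  apply: eq_Rintegral => t; rewrite inE => /system_green[_ bt_].
  by rewrite expr2 {2}bt_; ring.
have [_ sym] := green_symm X0 finD ha hb.
by rewrite Ea Eb sym; ring.
Qed.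

(** By the Cauchy-Schwarz inequality [(gamma - b(x))^2] is at most
    [r^2 * (integral of a^2) * (integral of rho(t) (x - t)^2)] wherever [rho x]
    is positive. Integrating this against [rho], the double integral of
    [rho(x) rho(t) (x - t)^2] is twice the determinant in the hypothesis. So [b]
    stays near its initial value [gamma] in the mean over [rho], unless [a] is
    large. *)
Lemma system_mass_bound (rho : R -> R) : bmfun D rho ->
  (forall t, 0 <= rho t <= 1) ->
  (forall x t, 0 < rho x -> t < x -> rho t = 1) ->
  r ^+ 2 * (J rho * J (fun t => rho t * t ^+ 2) - J (fun t => rho t * t) ^+ 2) <= 1 ->
  gamma ^+ 2 * J rho <= 4 * (J (fun t => a t ^+ 2) + J (fun t => b t ^+ 2)).
Proof.
move=> hr rho01 rho1.
set f := J rho; set m2 := J _; set m1 := J _; set A := J _; set B := J _ => hdelta.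
have A0 : 0 <= A by apply: Rintegral_ge0 => t _; exact: sqr_ge0.
have pt x : D x -> rho x * (gamma - b x) ^+ 2 <=
    (r ^+ 2 * A) * (f * (rho x * x ^+ 2) - (2 * m1) * (rho x * x) + m2 * rho x).
  move=> Dx; have [r0|rho_gt0] := leP (rho x) 0.
    have -> : rho x = 0 by apply/le_anti; rewrite r0; case/andP: (rho01 x).
    by rewrite !mul0r !mulr0 subr0 addr0 mulr0.
  rewrite (_ : _ * (_ - _ + _) = rho x * (r ^+ 2 * A * (f * x ^+ 2 - 2 * m1 * x + m2))); last by ring.
  rewrite ler_pM2l//.
  have [_ _ /(_ _ ((DE _).1 Dx))[_ ->]] := sol.
  rewrite opprB addrC subrK exprMn -mulrA ler_wpM2l ?sqr_ge0//.
  apply: le_trans (bmint_CS mD finD _ _) _ => //.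
  rewrite mulrC ler_wpM2l//.
  rewrite [leRHS](_ : _ = J (fun t => rho t * (x - t) ^+ 2)); last first.
    transitivity (x ^+ 2 * f - (2 * x) * m1 + m2); first by ring.
    rewrite -!bmintZ; [|bmsides..].
    rewrite -bmintB; [|bmsides..]; rewrite -bmintD; [|bmsides..].
    by apply: eq_Rintegral => t _; ring.
  apply: bmint_le => //; [by bmts..|move=> t Dt].
  rewrite /ramp; case: (leP x t) => [_|tx]; last by rewrite (rho1 x t)// mul1r.
  by rewrite subrr expr0n mulr_ge0 ?sqr_ge0//; case/andP: (rho01 t).
have S1 : J (fun t => rho t * (gamma - b t) ^+ 2) <= 2 * A.
  have := bmint_le mD finD _ _ pt => /(_ ltac:(by bmts) ltac:(by bmts)).
  rewrite bmintZ; [|bmsides..].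
  rewrite bmintD; [|bmsides..]; rewrite bmintB; [|bmsides..].
  rewrite !bmintZ; [|bmsides..].
  rewrite -/f -/m1 -/m2 => /le_trans; apply.
  have -> : r ^+ 2 * A * (f * m2 - 2 * m1 * m1 + m2 * f)
     = 2 * A * (r ^+ 2 * (f * m2 - m1 ^+ 2)) by ring.
  by rewrite ler_piMr// mulr_ge0.
apply: (@le_trans _ _ (2 * J (fun t => rho t * (gamma - b t) ^+ 2) + 2 * B)).
  rewrite -!bmintZ; [|bmsides..].
  rewrite -bmintD; [|bmsides..].
  apply: bmint_le => //; [by bmts..|move=> t Dt].
  have /andP[r0 r1] := rho01 t.
  apply: (@le_trans _ _ (rho t * (2 * (gamma - b t) ^+ 2 + 2 * b t ^+ 2))).
    rewrite mulrC ler_wpM2l// -subr_ge0.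
    rewrite (_ : _ - _ = (gamma - 2 * b t) ^+ 2) ?sqr_ge0//; ring.
  rewrite mulrDr mulrCA lerD2l ler_piMl// mulr_ge0 ?sqr_ge0//.
have B0 : 0 <= B by apply: Rintegral_ge0 => t _; exact: sqr_ge0.
by have := S1; lra.
Qed.

End Solution.

(** The solution [q phi - psi] with [q = psi(X) / phi(X)]: it has slope [-1] at the
    left end and vanishes at [X]. *)
Section Dirichlet.
Variables (r alpha gamma : R) (a b : R -> R).
Hypotheses (r0 : 0 < r) (sol : string_system m X r alpha (-1) gamma a b).
Hypotheses (aX : a X = 0) (bX : b X = 0).

Let hb : bmfun D b. Proof. by case: sol. Qed.
Let ha : bmfun D a. Proof. by case: sol. Qed.

(** This is the identity [Im q = r * |y|^2] for the Weyl solution. *)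
Lemma dirichlet_energy :
  r * (J (fun t => a t ^+ 2) + J (fun t => b t ^+ 2)) = gamma.
Proof.
rewrite (system_energy sol) aX bX !mul0r add0r mulN1r opprK add0r.
have [_ _ /(_ X)[]] := sol; first by rewrite X0 lexx.
move=> _; rewrite bX => /eqP; rewrite eq_sym subr_eq0 => /eqP ->.
by congr (_ * _); apply: eq_Rintegral => t; rewrite inE => Dt; rewrite rampX.
Qed.

Lemma dirichlet_ge0 : 0 <= gamma.
Proof.
rewrite -dirichlet_energy mulr_ge0 ?(ltW r0)//.
by apply: addr_ge0; apply: Rintegral_ge0 => t _; exact: sqr_ge0.
Qed.

(** [system_mass_bound] is quadratic in [gamma] on the left, while
    [dirichlet_energy] makes its right-hand side linear in [gamma]. *)
Lemma dirichlet_upper (rho : R -> R) : bmfun D rho ->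
  (forall t, 0 <= rho t <= 1) ->
  (forall x t, 0 < rho x -> t < x -> rho t = 1) ->
  r ^+ 2 * (J rho * J (fun t => rho t * t ^+ 2) - J (fun t => rho t * t) ^+ 2) <= 1 ->
  gamma * (r * J rho) <= 4.
Proof.
move=> hr h1 h2 h3; have := system_mass_bound sol hr h1 h2 h3.
have := dirichlet_ge0; rewrite le_eqVlt => /predU1P[<- _|g0]; first by rewrite mul0r.
set S := _ + _ => h; have ES : r * S = gamma := dirichlet_energy.
rewrite -(ler_pM2l g0) [leLHS](_ : _ = r * (gamma ^+ 2 * J rho)); last by ring.
by apply: le_trans (ler_wpM2l (ltW r0) h) _; rewrite mulrCA ES mulrC.
Qed.

(** The function [u := K g] satisfies [u(0) = 1] and [u(X) = 0], has slope [0] at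
    the left end, and [g] is its image under the Krein-Feller operator. Green's
    identity between [u] and [y] gives [r <u, b> + <g, a> = 1], and the
    inequality is Cauchy-Schwarz combined with [dirichlet_energy]. It is one half
    of the variational principle [1 / gamma = min (r |u|^2 + |g|^2 / r)]. *)
Lemma dirichlet_lower (g : R -> R) : bmfun D g ->
  J (fun t => (X - t) * g t) = 1 ->
  r <= gamma * (r ^+ 2 * J (fun t => K g t ^+ 2) + J (fun t => g t ^+ 2)).
Proof.
move=> hg g1; set U := J _; set G := J (fun t => g t ^+ 2).
have E : 1 = J (fun t => b t * (r * K g t)) + J (fun t => a t * g t).
  have -> : J (fun t => a t * g t) = 1 - r * J (fun t => g t * K b t).
    rewrite -g1 -bmintZ; [|bmsides..]; rewrite -bmintB; [|bmsides..].
    apply: eq_Rintegral => t; rewrite inE => Dt; have [-> _] := system_green sol Dt.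
    by rewrite aX; ring.
  rewrite (_ : J (fun t => b t * (r * K g t)) = r * J (fun t => b t * K g t)).
    by have [_ ->] := green_symm X0 finD hb hg; ring.
  rewrite -bmintZ; [|bmsides..].
  by apply: eq_Rintegral => t _; ring.
have hu : bmfun D (fun t => r * K g t) by bmts.
have := bmint_CS2 mD finD hb ha hu hg.
rewrite -E expr1n.
rewrite (_ : J (fun t => (r * K g t) ^+ 2) = r ^+ 2 * U); last first.
  rewrite -bmintZ; [|bmsides..].
  by apply: eq_Rintegral => t _; ring.
rewrite -/G addrC => h; rewrite -[leLHS]mulr1 -dirichlet_energy -mulrA.
by rewrite ler_pM2l// (addrC (J _)).
Qed.

End Dirichlet.
End SystemEstimates.

(** * Test functions *)

Section TestFunctions.
Variables (R : realType) (m : {measure set (measurableTypeR R) -> \bar R}) (X : R).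
Let D : set (measurableTypeR R) := `[0, X]%classic.
Hypotheses (X0 : 0 <= X) (finD : (m D < +oo)%E).
Variables (r alpha gamma : R) (a b : R -> R).
Hypotheses (r0 : 0 < r) (sol : string_system m X r alpha (-1) gamma a b).
Hypotheses (aX : a X = 0) (bX : b X = 0).
Local Notation J f := (\int[m]_(t in D) f t).
Local Notation K := (green m X).

Let mD : measurable D. Proof. exact: measurable_itv. Qed.

Let DE t : D t <-> 0 <= t <= X.
Proof. by rewrite /D /= in_itv. Qed.

Let bmid : bmfun D (fun t => t). Proof. exact: bmfun_id. Qed.
Let bmmax c : bmfun D (fun t => Num.max c t). Proof. exact: bmfun_max. Qed.
Let bmK f : bmfun D f -> bmfun D (K f).
Proof. by move=> hf; have [] := green_symm X0 finD hf hf. Qed.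

Ltac bmts := bmt; try first [exact: bmid | exact: bmmax | by apply: bmK].
Ltac bmsides := match goal with |- bmfun _ _ => by bmts | _ => assumption end.

(** The test function is taken to vanish beyond [tau], which amounts to
    [integral of g = 0] and [integral of t g = - 1]. The density [g] of least norm
    under these two constraints is [rho] times an affine function, and its norm
    squared is [f / delta]. As [g] changes sign once, from positive to negative,
    [u] decreases from [1] to [0], whence [|u|^2 <= f]. *)
Lemma dirichlet_lower_truncated (rho : R -> R) (tau : R) : bmfun D rho ->
  (forall t, 0 <= rho t <= 1) ->
  (forall t, t < tau -> rho t = 1) -> (forall t, tau < t -> rho t = 0) ->
  let f := J rho in
  let delta := f * J (fun t => rho t * t ^+ 2) - J (fun t => rho t * t) ^+ 2 in
  0 < delta ->
  r <= gamma * (r ^+ 2 * f + f / delta).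
Proof.
move=> hr rho01 rho_lt rho_gt f; set m2 := J _; set m1 := J _ => delta delta_gt0.
have f0 : 0 <= f by apply: Rintegral_ge0 => t _; case/andP: (rho01 t).
have f_gt0 : 0 < f.
  rewrite lt_neqAle f0 andbT; apply/eqP => fE; move: delta_gt0.
  by rewrite /delta -fE mul0r add0r oppr_gt0 ltNge sqr_ge0.
pose g t := delta^-1 * (rho t * (m1 - f * t)).
have hg : bmfun D g by rewrite /g; bmts.
have g0 : J g = 0.
  rewrite bmintZ; [|bmsides..].
  transitivity (delta^-1 * (m1 * f - f * m1)); last by ring.
  congr (_ * _); rewrite -!bmintZ; [|bmsides..].
  rewrite -bmintB; [|bmsides..].
  by apply: eq_Rintegral => t _; ring.
have g1 : J (fun t => t * g t) = - 1.
  transitivity (delta^-1 * (m1 * m1 - f * m2)); last first.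
    rewrite (_ : _ - _ = - delta); last by rewrite /delta; ring.
    by rewrite mulrN mulVf// lt0r_neq0.
  transitivity (J (fun t => delta^-1 * (m1 * (rho t * t) - f * (rho t * t ^+ 2)))).
    by apply: eq_Rintegral => t _; rewrite /g; ring.
  rewrite bmintZ; [|bmsides..].
  rewrite bmintB; [|bmsides..].
  by rewrite !bmintZ//; bmts.
have gc c : J (fun t => c * g t) = 0 by rewrite bmintZ// g0 mulr0.
have gX c : J (fun t => (c - t) * g t) = 1.
  transitivity (J (fun t => c * g t) - J (fun t => t * g t)).
    rewrite -bmintB; [|bmsides..].
    by apply: eq_Rintegral => t _; ring.
  by rewrite gc g1 opprK add0r.
(* Since g has integral zero, the constant X of the Green kernel is arbitrary. *)
have Kc x c : K g x = J (fun t => (c - Num.max x t) * g t).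
  transitivity (J (fun t => (c - Num.max x t) * g t) + J (fun t => (X - c) * g t)).
    rewrite -bmintD; [|bmsides..].
    by apply: eq_Rintegral => t _; ring.
  by rewrite gc addr0.
pose mean := m1 / f.
have gE t : g t = (delta^-1 * rho t * f) * (mean - t).
  by rewrite /g /mean; field; rewrite !lt0r_neq0.
have c0 t : 0 <= delta^-1 * rho t * f.
  by rewrite !mulr_ge0 ?invr_ge0 ?(ltW delta_gt0)//; case/andP: (rho01 t).
(* With the constant chosen to make the kernel vanish at the mean, the kernel
   and g change sign at the same point. *)
have K_ge0 x : 0 <= K g x.
  rewrite (Kc x (Num.max x mean)); apply: Rintegral_ge0 => t _.
  rewrite gE mulrCA mulr_ge0//.
  have [tm|mt] := leP t mean.
    by rewrite mulr_ge0 ?subr_ge0// ge_max !le_max lexx tm !orbT.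
  by rewrite mulr_le0 ?subr_le0// ?ge_max ?le_max ?lexx ?(ltW mt) ?orbT.
have K_le1 x : K g x <= 1.
  rewrite -subr_ge0.
  have -> : 1 - K g x = J (fun t => (ramp x t - ramp x mean) * g t).
    rewrite -[LHS]subr0 -[in LHS](gX X) (Kc x X) -[in LHS](gc (ramp x mean)).
    rewrite -bmintB; [|bmsides..]; rewrite -bmintB; [|bmsides..].
    by apply: eq_Rintegral => t _; rewrite /ramp; ring.
  apply: Rintegral_ge0 => t _; rewrite gE mulrCA mulr_ge0// /ramp.
  have [tm|mt] := leP t mean.
    rewrite mulr_ge0 ?subr_ge0//.
    by case: (leP x t) => xt; case: (leP x mean) => xm; lra.
  rewrite mulr_le0 ?subr_le0 ?(ltW mt)//.
  by case: (leP x t) => xt; case: (leP x mean) => xm; lra.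
have K_eq0 x : tau <= x -> K g x = 0.
  move=> tx; rewrite -(gc (X - x)) (Kc x X); apply: eq_Rintegral => t _.
  have [xt|tx'] := leP x t; last by [].
  move: xt; rewrite le_eqVlt => /predU1P[->//|xt].
  by rewrite /g (rho_gt t) ?(le_lt_trans tx)// !mul0r !mulr0.
have JK : J (fun t => K g t ^+ 2) <= f.
  apply: bmint_le => //; [by bmts..|move=> x _].
  have [xtau|tx] := ltP x tau.
    by rewrite rho_lt// expr_le1.
  by rewrite K_eq0// expr0n/=; case/andP: (rho01 x).
have Jg : J (fun t => g t ^+ 2) <= f / delta.
  apply: (@le_trans _ _ (J (fun t => delta^-1 ^+ 2 * (m1 ^+ 2 * rho t
      - (2 * m1 * f) * (rho t * t) + f ^+ 2 * (rho t * t ^+ 2))))).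
    apply: bmint_le => //; [by bmts..|move=> t _].
    rewrite /g exprMn ler_wpM2l ?sqr_ge0//.
    rewrite [leRHS](_ : _ = rho t * (m1 - f * t) ^+ 2); last by ring.
    rewrite exprMn ler_wpM2r ?sqr_ge0//.
    by case/andP: (rho01 t) => ? ?; rewrite expr2 ler_piMl.
  rewrite bmintZ; [|bmsides..].
  rewrite bmintD; [|bmsides..]; rewrite bmintB; [|bmsides..].
  rewrite !bmintZ; [|bmsides..].
  rewrite -/f -/m1 -/m2 (_ : _ - _ + _ = f * delta); last by rewrite /delta; ring.
  rewrite [leLHS](_ : _ = f / delta)//.
  by field; rewrite lt0r_neq0.
have := dirichlet_lower X0 finD r0 sol aX bX hg (gX X).
move/le_trans; apply; rewrite ler_wpM2l//; first exact: (dirichlet_ge0 X0 finD r0 sol aX bX).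
by rewrite lerD// ler_wpM2l// sqr_ge0.
Qed.

(** When the determinant never reaches [1 / r^2] there is no point beyond which the
    test function should vanish. With constant [g] the test function decreases to
    [0] along the whole interval, and [g] is small if the interval is long. *)
Lemma dirichlet_lower_constant : let q := J (fun t => X - t) in 0 < q ->
  r <= gamma * (r ^+ 2 * J (fun=> 1) + J (fun=> 1) / q ^+ 2).
Proof.
move=> q q0; have hg : bmfun D (fun=> q^-1) by bmts.
have gX : J (fun t => (X - t) * q^-1) = 1.
  transitivity (q^-1 * q); last by rewrite mulVf// lt0r_neq0.
  rewrite -bmintZ; [|bmsides..].
  by apply: eq_Rintegral => t _; rewrite mulrC.
have := dirichlet_lower X0 finD r0 sol aX bX hg gX.
move/le_trans; apply; rewrite ler_wpM2l//; first exact: (dirichlet_ge0 X0 finD r0 sol aX bX).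
apply: lerD.
  rewrite ler_wpM2l ?sqr_ge0//; apply: bmint_le => //; [by bmts..|move=> x Dx].
  have /andP[x0 xX] := (DE _).1 Dx.
  rewrite expr_le1//.
    rewrite -gX; apply: bmint_le => //; [by bmts..|move=> t Dt].
    by rewrite ler_wpM2r ?invr_ge0 ?(ltW q0)// lerD2l lerN2 le_max lexx orbT.
  apply: Rintegral_ge0 => t /DE/andP[t0 tX].
  by rewrite mulr_ge0 ?invr_ge0 ?(ltW q0)// subr_ge0 ge_max xX.
rewrite (_ : _ / q ^+ 2 = q^-1 ^+ 2 * J (fun=> 1)); last by rewrite exprVn mulrC.
rewrite -bmintZ; [|bmsides..].
by under [leRHS]eq_Rintegral do rewrite mulr1.
Qed.

End TestFunctions.

(** * The string equation as a real system *)

Section StringIntegrals.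
Variables (R : realType) (S : krein_string R).
Local Notation m := (smass S).
Local Notation L := (slen S).
Local Notation J X f := (\int[m]_(t in `[0%R, X]) f t).

Lemma string_fin X : (X%:E < L)%E -> (m (`[0%R, X]%classic) < +oo)%E.
Proof.
move=> XL; have [X0|X0] := leP 0 X; first exact: smass_fin.
by rewrite set_itv_ge ?measure0 ?ltry// bnd_simp -ltNge.
Qed.

Lemma itv_measurable X : measurable (`[0%R, X]%classic : set (measurableTypeR R)).
Proof. exact: measurable_itv. Qed.

Lemma bmfun_le (D : set (measurableTypeR R)) (c : R) : measurable D ->
  bmfun D (fun t : R => (t <= c)%R%:R : R).
Proof.
move=> mD; apply: (@bmfun_bool _ (measurableTypeR R)).
by apply: measurable_fun_ler; [exact: measurable_id|exact: measurable_cst].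
Qed.

Lemma bmfun_lt (D : set (measurableTypeR R)) (c : R) : measurable D ->
  bmfun D (fun t : R => (t < c)%R%:R : R).
Proof.
move=> mD; apply: (@bmfun_bool _ (measurableTypeR R)).
by apply: measurable_fun_ltr; [exact: measurable_id|exact: measurable_cst].
Qed.

Lemma Rintegral_restrict (X Y : R) (f : R -> R) : X <= Y ->
  J X f = J Y (fun t => (t <= X)%R%:R * f t).
Proof.
move=> XY; rewrite Rintegral_mkcond [RHS]Rintegral_mkcond.
apply: eq_Rintegral => t _; rewrite !patchE !mem_setE !in_itv/=.
have [tX|Xt] := leP t X; first by rewrite (le_trans tX XY) mul1r andbT.
by rewrite andbF mul0r; case: ifP.
Qed.

(** A solution is only assumed integrable; the equation itself makes it bounded on
    [[0, X]], by its data and the integral of its modulus. *)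
Lemma string_solution_system (p q r : R) (z : R -> R[i]) (X : R) :
  0 <= r -> 0 <= X -> (X%:E < L)%E ->
  string_solution S (fun x => p + q * x) (0 +i* r) z ->
  string_system m X r p q 0 (fun t => complex.Re (z t)) (fun t => complex.Im (z t)).
Proof.
move=> r0 X0 XL sol.
pose a t := complex.Re (z t); pose b t := complex.Im (z t).
pose D : set (measurableTypeR R) := `[0, X]%classic.
have finD : (m D < +oo)%E by exact: smass_fin.
have mD : measurable D by exact: measurable_itv.
have [[ia ib] _] := sol _ X0 XL.
have E x : 0 <= x <= X -> a x = p + q * x + r * J X (fun t => ramp x t * b t) /\
    b x = 0 - r * J X (fun t => ramp x t * a t).
  move=> /andP[x0 xX].
  have xL : (x%:E < L)%E by apply: le_lt_trans XL; rewrite lee_fin.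
  have [_ zx] := sol x x0 xL.
  have JE (f : R -> R) : J X (fun t => ramp x t * f t) = J x (fun t => (x - t) * f t).
    rewrite (Rintegral_restrict _ xX); apply: eq_Rintegral => t _.
    rewrite /ramp; have [tx|xt] := leP t x; first by rewrite mul1r.
    by rewrite subrr mul0r mul0r.
  have Ec : cintegral S `[0, x]%classic (fun t => (x - t)%:C * z t) =
      (J x (fun t => (x - t) * a t)) +i* (J x (fun t => (x - t) * b t)).
    by congr (_ +i* _); apply: eq_Rintegral => t _;
      rewrite /a /b; case: (z t) => u v /=; ring.
  by rewrite /a /b zx Ec /= !JE; split; ring.
have bnd (f : R -> R) x : m.-integrable D (EFin \o f) -> 0 <= x <= X ->
    `|J X (fun t => ramp x t * f t)| <= X * J X (fun t => `|f t|).
  move=> intf /andP[x0 xX].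
  have mf : measurable_fun D f by apply/measurable_EFinP/measurable_int/intf.
  have rampX' t : D t -> `|ramp x t| <= X.
    rewrite /D /= in_itv/= => /andP[t0 tX].
    rewrite ger0_norm ?ramp_ge0// /ramp.
    by case: (leP x t); lra.
  have iXf : m.-integrable D (EFin \o (fun t => X * `|f t|)).
    by have := integrableZl mD X (integrable_norm intf).
  have irf : m.-integrable D (EFin \o (fun t => ramp x t * f t)).
    apply: (le_integrable mD _ _ iXf) => //.
      apply/measurable_EFinP; apply: measurable_funM => //.
      by case: (bmfun_ramp X0 x).
    move=> t Dt; rewrite /= lee_fin normrM [leRHS]ger0_norm ?mulr_ge0//.
    by rewrite ler_wpM2r// rampX'.
  apply: le_trans (le_normr_Rintegral mD irf) _.
  rewrite -RintegralZl//; last exact: integrable_norm.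
  apply: le_Rintegral => //; first exact: integrable_norm.
  by move=> t Dt; rewrite normrM ler_wpM2r// rampX'.
split=> //.
- split; first by apply/measurable_EFinP/measurable_int/ia.
  exists (`|p| + `|q| * X + r * (X * J X (fun t => `|b t|))) => x.
  rewrite /= in_itv/= => xX; rewrite -/(a x); have [-> _] := E _ xX; have /andP[x0 xX'] := xX.
  apply: le_trans (ler_normD _ _) (lerD _ _).
    apply: le_trans (ler_normD _ _) (lerD _ _) => //.
    by rewrite normrM ler_wpM2l// ger0_norm.
  by rewrite normrM ger0_norm// ler_wpM2l// bnd.
- split; first by apply/measurable_EFinP/measurable_int/ib.
  exists (r * (X * J X (fun t => `|a t|))) => x.
  rewrite /= in_itv/= => xX; have /andP[x0 xX'] := xX.
  rewrite -/(b x); have [_ ->] := E _ xX; by rewrite sub0r normrN normrM ger0_norm// ler_wpM2l// bnd.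
Qed.

End StringIntegrals.

(** * Dependence of integrals on the right end *)

Section MonotoneIntegrals.
Variables (R : realType) (S : krein_string R).
Local Notation m := (smass S).
Local Notation L := (slen S).
Local Notation J X f := (\int[m]_(t in `[0%R, X]) f t).
Local Notation bmi X := (bmfun (`[0, X]%classic : set (measurableTypeR R))).

Lemma Rintegral_le_itv (X Y : R) (f : R -> R) : X <= Y -> (Y%:E < L)%E ->
  bmi Y f -> (forall t, 0 <= f t) -> J X f <= J Y f.
Proof.
move=> XY YL hf f0; rewrite (Rintegral_restrict S f XY).
apply: bmint_le => //.
- exact: string_fin.
- by apply: bmfunM => //; exact: bmfun_le.
- by move=> t _; case: (t <= X); rewrite ?mul1r// mul0r.
Qed.

Lemma Rintegral_tail_le (X Y : R) (f : R -> R) : X <= Y -> (Y%:E < L)%E ->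
  bmi Y f ->
  `|J Y f - J X f| <= J Y (fun t => `|f t|) - J X (fun t => `|f t|).
Proof.
move=> XY YL hf; rewrite !(Rintegral_restrict S _ XY).
have fin := string_fin YL; have mD := itv_measurable Y.
have ht : bmi Y (fun t : R => (t <= X)%R%:R : R) by exact: bmfun_le.
have hn := bmfun_norm hf.
rewrite -!bmintB; [|bmside..].
apply: le_trans (le_normr_Rintegral _ _) _ => //.
  by apply: bmfun_integrable => //; bmt.
apply: bmint_le => //; [by apply: bmfun_norm; bmt|by bmt|move=> t _].
by case: (t <= X); rewrite ?mul1r ?subrr ?normr0// !mul0r !subr0.
Qed.

Lemma Rintegral_sqr_le (X : R) (f : R -> R) : (X%:E < L)%E -> bmi X f ->
  J X f ^+ 2 <= J X (fun=> 1) * J X (fun t => f t ^+ 2).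
Proof.
move=> XL hf; have fin := string_fin XL; have mD := itv_measurable X.
have := bmint_CS mD fin (bmfun_cst _ 1) hf.
rewrite (_ : J X (fun=> 1 ^+ 2) = J X (fun=> 1)).
  rewrite (_ : J X (fun t => 1 * f t) = J X f)//.
  by apply: eq_Rintegral => t _; rewrite mul1r.
by apply: eq_Rintegral => t _; rewrite expr1n.
Qed.

(** Write the square as a double integral and split it along the diagonal. The
    half above the diagonal is folded onto the other one by Fubini; the diagonal
    itself, which may carry mass, is counted once. *)
Lemma sqr_Rintegral_triangle (X : R) (f : R -> R) : 0 <= X -> (X%:E < L)%E -> bmi X f ->
  let w x := f x * (J x f + J x (fun t => (t < x)%R%:R * f t)) in
  bmi X w /\ J X f ^+ 2 = J X w.
Proof.
move=> X0 XL hf w.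
have fin := string_fin XL; have mD := itv_measurable X.
have [mf [M hM]] := hf.
pose D : set (measurableTypeR R) := `[0, X]%classic.
have mfst : measurable_fun (D `*` D)
    (fun p : measurableTypeR R * measurableTypeR R => f p.1).
  apply: (measurable_comp (F := D)) => //; first by move=> _ [[x y] [Dx Dy] <-].
  by apply: measurable_funTS; exact: measurable_fst.
have msnd : measurable_fun (D `*` D)
    (fun p : measurableTypeR R * measurableTypeR R => f p.2).
  apply: (measurable_comp (F := D)) => //; first by move=> _ [[x y] [Dx Dy] <-].
  by apply: measurable_funTS; exact: measurable_snd.
have mlt : measurable_fun (D `*` D)
    (fun p : measurableTypeR R * measurableTypeR R => (p.2 < p.1)%R%:R : R).
  suff [] : @bmfun _ _ R (D `*` D) (fun p : measurableTypeR R * measurableTypeR R =>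
      (p.2 < p.1)%R%:R) by [].
  apply: bmfun_bool.
  by apply: measurable_fun_ltr; apply: measurable_funTS;
    [exact: measurable_snd|exact: measurable_fst].
have hlt (x : R) : bmi X (fun t : R => (t < x)%R%:R : R) by exact: bmfun_lt.
have hle (x : R) : bmi X (fun t : R => (t <= x)%R%:R : R) by exact: bmfun_le.
have hgt (x : R) : bmi X (fun t : R => (x < t)%R%:R : R).
  apply: (@bmfun_bool _ (measurableTypeR R)).
  by apply: measurable_fun_ltr; [exact: measurable_cst|exact: measurable_id].
have bool1 (b : bool) : `|b%:R : R| <= 1 by case: b; rewrite ?normr1 ?normr0.
have [||bG E] := @bmint_fubini _ _ _ m D mD fin
  (fun x t : R => f x * ((t < x)%R%:R * f t)).
- by apply: measurable_funM => //; exact: measurable_funM.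
- exists (M * (1 * M)) => x t Dx Dt.
  by rewrite !normrM ler_pM ?mulr_ge0 ?ler_pM ?hM.
have wE x : D x -> w x =
    f x * J X f - J X (fun t => f t * ((x < t)%R%:R * f x))
    + J X (fun t => f x * ((t < x)%R%:R * f t)).
  rewrite /D/= in_itv/= => /andP[x0 xX]; rewrite /w.
  rewrite !(Rintegral_restrict S _ xX) -bmintZ; [|bmside..].
  rewrite -bmintB; [|bmside..]; rewrite -bmintD; [|bmside..].
  rewrite -bmintD; [|bmside..]; rewrite -bmintZ; [|bmside..].
  apply: eq_Rintegral => t _.
  by case: (ltgtP t x) => _; rewrite ?mul1r ?mul0r; ring.
have [||bG2 _] := @bmint_fubini _ _ _ m D mD fin
  (fun x t : R => f t * ((x < t)%R%:R * f x)).
- apply: (measurable_funM msnd); apply: (fun h => measurable_funM h mfst).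
  suff [] : @bmfun _ _ R (D `*` D) (fun p : measurableTypeR R * measurableTypeR R =>
      (p.1 < p.2)%R%:R) by [].
  apply: bmfun_bool.
  by apply: measurable_fun_ltr; apply: measurable_funTS;
    [exact: measurable_fst|exact: measurable_snd].
- exists (M * (1 * M)) => x t Dx Dt.
  by rewrite !normrM ler_pM ?mulr_ge0 ?ler_pM ?hM.
have bw : bmi X w.
  apply: (bmfun_ext (f := fun x => f x * J X f
    - J X (fun t => f t * ((x < t)%R%:R * f x))
    + J X (fun t => f x * ((t < x)%R%:R * f t)))).
    by move=> x; rewrite inE => Dx; rewrite wE.
  by bmt.
split; first exact: bw.
transitivity (J X (fun x => f x * J X f
    - J X (fun t => f t * ((x < t)%R%:R * f x))
    + J X (fun t => f x * ((t < x)%R%:R * f t)))); last first.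
  by apply: eq_Rintegral => x; rewrite inE => Dx; rewrite wE.
rewrite bmintD; [|bmside..]; rewrite bmintB; [|bmside..].
rewrite E subrK expr2 -bmintZ; [|bmside..].
by apply: eq_Rintegral => t _; rewrite mulrC.
Qed.

End MonotoneIntegrals.

(** * The solution phi and the Weyl quotient of a truncated string *)

Section FundamentalSystem.
Variables (R : realType) (S : krein_string R) (r : R) (phi1 phi2 psi1 psi2 : R -> R).
Local Notation m := (smass S).
Local Notation L := (slen S).
Local Notation J X f := (\int[m]_(t in `[0%R, X]) f t).
Local Notation bmi X := (bmfun (`[0, X]%classic : set (measurableTypeR R))).
Hypothesis r0 : 0 < r.
Hypothesis sol_phi : forall X, 0 <= X -> (X%:E < L)%E ->
  string_system m X r 1 0 0 phi1 phi2.
Hypothesis sol_psi : forall X, 0 <= X -> (X%:E < L)%E ->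
  string_system m X r 0 1 0 psi1 psi2.

Definition phi_norm2 t := phi1 t ^+ 2 + phi2 t ^+ 2.
Definition phi_energy X := J X phi_norm2.
Definition mass X := J X (fun=> 1).

Section FixedEnd.
Variable X : R.
Hypotheses (X0 : 0 <= X) (XL : (X%:E < L)%E).

Let mD : measurable (`[0, X]%classic : set (measurableTypeR R)).
Proof. exact: itv_measurable. Qed.
Let finD : (m (`[0%R, X]%classic) < +oo)%E. Proof. exact: string_fin. Qed.

Lemma bmfun_phi1 : bmi X phi1. Proof. by case: (sol_phi X0 XL). Qed.
Lemma bmfun_phi2 : bmi X phi2. Proof. by case: (sol_phi X0 XL). Qed.
Lemma bmfun_psi1 : bmi X psi1. Proof. by case: (sol_psi X0 XL). Qed.
Lemma bmfun_psi2 : bmi X psi2. Proof. by case: (sol_psi X0 XL). Qed.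

Lemma bmfun_phi_norm2 : bmi X phi_norm2.
Proof. by apply: bmfunD; apply: bmfunX; [exact: bmfun_phi1|exact: bmfun_phi2]. Qed.

Lemma phi_energyE : phi_energy X = J X (fun t => phi1 t ^+ 2) + J X (fun t => phi2 t ^+ 2).
Proof.
have h1 := bmfun_phi1; have h2 := bmfun_phi2.
by rewrite /phi_energy /phi_norm2 bmintD; [|bmside..].
Qed.

(** The energy identity for [phi], whose slope at the left end is zero. *)
Lemma phi_energy_boundary : phi_energy X = phi1 X * J X phi1 + phi2 X * J X phi2.
Proof.
by rewrite phi_energyE (system_energy X0 finD (sol_phi X0 XL)) mul0r subr0.
Qed.

Lemma mass_ge0 : 0 <= mass X.
Proof. by apply: Rintegral_ge0. Qed.

Lemma phi_norm2_ge0 t : 0 <= phi_norm2 t.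
Proof. by rewrite addr_ge0 ?sqr_ge0. Qed.

Lemma phi_energy_ge0 : 0 <= phi_energy X.
Proof. by apply: Rintegral_ge0 => t _; exact: phi_norm2_ge0. Qed.

Lemma sum_sqr_int_phi_le : J X phi1 ^+ 2 + J X phi2 ^+ 2 <= mass X * phi_energy X.
Proof.
rewrite phi_energyE mulrDr lerD//.
  exact: Rintegral_sqr_le XL bmfun_phi1.
exact: Rintegral_sqr_le XL bmfun_phi2.
Qed.

(** The modulus of [phi(X)] is at least the root mean square of [phi] over [[0, X]]:
    apply Cauchy-Schwarz twice in [phi_energy_boundary]. This is a weak form of the
    monotonicity of [|phi|]. *)
Lemma phi_energy_le : phi_energy X <= phi_norm2 X * mass X.
Proof.
have := phi_energy_ge0; rewrite le_eqVlt => /predU1P[<-|P0].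
  by rewrite mulr_ge0 ?mass_ge0// phi_norm2_ge0.
rewrite -(ler_pM2r P0) -mulrA.
apply: (@le_trans _ _ (phi_norm2 X * (J X phi1 ^+ 2 + J X phi2 ^+ 2))); last first.
  by rewrite ler_wpM2l ?phi_norm2_ge0 ?sum_sqr_int_phi_le.
rewrite {1}phi_energy_boundary {1}phi_energy_boundary /phi_norm2 -subr_ge0.
rewrite [leRHS](_ : _ = (phi1 X * J X phi2 - phi2 X * J X phi1) ^+ 2) ?sqr_ge0//.
ring.
Qed.

(** If [phi] had zero energy, the integral equation would give [phi1 = 1] on [[0, X]],
    so that the energy would be the mass. *)
Lemma phi_energy_gt0 : 0 < mass X -> 0 < phi_energy X.
Proof.
move=> M0; rewrite lt_neqAle phi_energy_ge0 andbT; apply/eqP => P0.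
have h1 := bmfun_phi1; have h2 := bmfun_phi2.
have sq0 : J X (fun t => phi2 t ^+ 2) = 0.
  apply/le_anti/andP; split; last by apply: Rintegral_ge0 => t _; exact: sqr_ge0.
  rewrite [leRHS]P0 phi_energyE lerDr.
  by apply: Rintegral_ge0 => t _; exact: sqr_ge0.
have ramp0 x : J X (fun t => ramp x t * phi2 t) = 0.
  apply/eqP; rewrite -sqrf_eq0; apply/eqP/le_anti/andP; split; last exact: sqr_ge0.
  apply: le_trans (bmint_CS mD finD (bmfun_ramp X0 x) h2) _.
  by rewrite sq0 mulr0.
have phi11 x : `[0, X]%classic x -> phi1 x = 1.
  rewrite /= in_itv/= => xX; have [_ _ /(_ _ xX)[-> _]] := sol_phi X0 XL.
  by rewrite ramp0 mulr0 mul0r !addr0.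
have Em : mass X = J X (fun t => phi1 t ^+ 2).
  by apply: eq_Rintegral => t; rewrite inE => /phi11 ->; rewrite expr1n.
by move: phi_energyE M0; rewrite -P0 sq0 addr0 -Em => <-; rewrite ltxx.
Qed.

Lemma phi_norm2_gt0 : 0 < mass X -> 0 < phi_norm2 X.
Proof.
move=> M0; rewrite -(pmulr_lgt0 _ M0).
exact: lt_le_trans (phi_energy_gt0 M0) phi_energy_le.
Qed.

(** The real part of [psi / phi] at [X]; its imaginary part is [weyl_im]. *)
Definition weyl_re := (psi1 X * phi1 X + psi2 X * phi2 X) / phi_norm2 X.
Definition weyl_im := (psi2 X * phi1 X - psi1 X * phi2 X) / phi_norm2 X.

Lemma weyl_system (q1 q2 : R) :
  string_system m X r q1 (-1) q2 (fun t => q1 * phi1 t - q2 * phi2 t - psi1 t)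
    (fun t => q1 * phi2 t + q2 * phi1 t - psi2 t).
Proof.
have h1 := bmfun_phi1; have h2 := bmfun_phi2.
have k1 := bmfun_psi1; have k2 := bmfun_psi2.
split; [by bmt|by bmt|move=> x xX].
have hramp := bmfun_ramp X0 x.
have [_ _ /(_ _ xX)[-> ->]] := sol_phi X0 XL.
have [_ _ /(_ _ xX)[-> ->]] := sol_psi X0 XL.
have Eb : J X (fun t => ramp x t * (q1 * phi2 t + q2 * phi1 t - psi2 t)) =
    q1 * J X (fun t => ramp x t * phi2 t) + q2 * J X (fun t => ramp x t * phi1 t)
    - J X (fun t => ramp x t * psi2 t).
  rewrite -!bmintZ; [|bmside..]; rewrite -bmintD; [|bmside..].
  rewrite -bmintB; [|bmside..]; apply: eq_Rintegral => t _; ring.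
have Ea : J X (fun t => ramp x t * (q1 * phi1 t - q2 * phi2 t - psi1 t)) =
    q1 * J X (fun t => ramp x t * phi1 t) - q2 * J X (fun t => ramp x t * phi2 t)
    - J X (fun t => ramp x t * psi1 t).
  rewrite -!bmintZ; [|bmside..]; rewrite -bmintB; [|bmside..].
  rewrite -bmintB; [|bmside..]; apply: eq_Rintegral => t _; ring.
by rewrite Ea Eb; split; ring.
Qed.

Lemma weyl_vanish : 0 < mass X ->
  weyl_re * phi1 X - weyl_im * phi2 X - psi1 X = 0 /\
  weyl_re * phi2 X + weyl_im * phi1 X - psi2 X = 0.
Proof.
move=> /phi_norm2_gt0/lt0r_neq0; rewrite /weyl_re /weyl_im /phi_norm2 => h0.
by split; field.
Qed.

End FixedEnd.

Lemma phi_energy_nondecreasing X Y : X <= Y -> (Y%:E < L)%E ->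
  phi_energy X <= phi_energy Y.
Proof.
move=> XY YL; have [Y0|Y0] := leP 0 Y.
  apply: Rintegral_le_itv => //; last exact: phi_norm2_ge0.
  exact: bmfun_phi_norm2.
have e Z : Z < 0 -> phi_energy Z = 0.
  by move=> Z0; rewrite /phi_energy set_itv_ge ?Rintegral_set0// bnd_simp -ltNge.
by rewrite !e// (le_lt_trans XY).
Qed.

Lemma mass_nondecreasing X Y : X <= Y -> (Y%:E < L)%E -> mass X <= mass Y.
Proof. by move=> XY YL; apply: Rintegral_le_itv => //; exact: bmfun_cst. Qed.

(** The squared modulus of the right derivative of [phi], divided by [r ^+ 2]. *)
Definition slope2 X := J X phi1 ^+ 2 + J X phi2 ^+ 2.

Lemma slope2_gt0 X : 0 <= X -> (X%:E < L)%E -> 0 < mass X -> 0 < slope2 X.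
Proof.
move=> X0 XL M0; rewrite lt_neqAle addr_ge0 ?sqr_ge0// andbT; apply/eqP => s0.
have := phi_energy_gt0 X0 XL M0; rewrite phi_energy_boundary//.
move: s0 => /esym/eqP; rewrite paddr_eq0 ?sqr_ge0// !sqrf_eq0 => /andP[/eqP-> /eqP->].
by rewrite !mulr0 addr0 ltxx.
Qed.

(** By [sqr_Rintegral_triangle] the squared slope is the integral over [[0, X]] of
    [w x], and [phi_energy_boundary] at the end [x] identifies [w x] with the sum of
    the energies of [phi] over [[0, x]] and over [[0, x[], which is nonnegative. *)
Lemma slope2_nondecreasing X Y : 0 <= X -> X <= Y -> (Y%:E < L)%E ->
  slope2 X <= slope2 Y.
Proof.
move=> X0 XY YL.
have XL : (X%:E < L)%E by apply: le_lt_trans YL; rewrite lee_fin.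
pose w x := phi1 x * (J x phi1 + J x (fun t => (t < x)%R%:R * phi1 t))
          + phi2 x * (J x phi2 + J x (fun t => (t < x)%R%:R * phi2 t)).
have wE Z : 0 <= Z -> (Z%:E < L)%E -> bmi Z w /\ slope2 Z = J Z w.
  move=> Z0 ZL; have fin := string_fin ZL; have mD := itv_measurable Z.
  have [b1 E1] := sqr_Rintegral_triangle Z0 ZL (bmfun_phi1 Z0 ZL).
  have [b2 E2] := sqr_Rintegral_triangle Z0 ZL (bmfun_phi2 Z0 ZL).
  split; first by apply: bmfunD; [exact: b1|exact: b2].
  by rewrite /slope2 E1 E2 -bmintD; [|exact: mD|exact: fin|exact: b1|exact: b2].
have w0 x : 0 <= x -> (x%:E < L)%E -> 0 <= w x.
  move=> x0 xL; have fin := string_fin xL; have mD := itv_measurable x.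
  have h1 := bmfun_phi1 x0 xL; have h2 := bmfun_phi2 x0 xL.
  have hh := bmfun_phi_norm2 x0 xL.
  have hlt : bmi x (fun t : R => (t < x)%R%:R : R) by exact: bmfun_lt.
  rewrite /w !mulrDr addrACA -phi_energy_boundary//.
  rewrite addr_ge0 ?phi_energy_ge0//.
  rewrite (_ : _ + _ = J x (fun t => (t < x)%R%:R * phi_norm2 t)).
    by apply: Rintegral_ge0 => t _; rewrite mulr_ge0// phi_norm2_ge0.
  have E : phi_energy x - J x (fun t => (t < x)%R%:R * phi_norm2 t) =
      (phi1 x * J x phi1 + phi2 x * J x phi2) -
      (phi1 x * J x (fun t => (t < x)%R%:R * phi1 t) +
       phi2 x * J x (fun t => (t < x)%R%:R * phi2 t)).
    rewrite /phi_energy -!bmintZ; [|bmside..].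
    rewrite -!bmintD; [|bmside..]; rewrite -!bmintB; [|bmside..].
    apply: eq_Rintegral => t; rewrite inE /= in_itv/= => /andP[t0 tx].
    rewrite /phi_norm2; have [tx'|] := ltP t x; first by rewrite !mul1r; ring.
    move=> xt; have -> : t = x by apply/le_anti/andP.
    by rewrite !mul0r; ring.
  by move: E; rewrite -phi_energy_boundary//; lra.
have [bX ->] := wE _ X0 XL.
have [bY ->] := wE _ (le_trans X0 XY) YL.
have -> : J X w = J X (fun t => `|w t|).
  apply: eq_Rintegral => t; rewrite inE /= in_itv/= => /andP[t0 tX].
  by rewrite ger0_norm// w0// (le_lt_trans _ XL)// lee_fin.
have -> : J Y w = J Y (fun t => `|w t|).
  apply: eq_Rintegral => t; rewrite inE /= in_itv/= => /andP[t0 tY].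
  by rewrite ger0_norm// w0// (le_lt_trans _ YL)// lee_fin.
by apply: Rintegral_le_itv => //; exact: bmfun_norm.
Qed.

End FundamentalSystem.

(** * Limits at the right end of the string *)

Lemma cvg_near_eq (T : Type) (F : set_system T) {FF : Filter F} (R : realType)
    (f g : T -> R) (l : R) : (\forall x \near F, f x = g x) ->
  (g x @[x --> F] --> l) -> (f x @[x --> F] --> l).
Proof. move=> fg gl; apply: cvg_trans gl; apply: near_eq_cvg.
by apply: filterS fg => x ->. Qed.

Lemma cvg_complex (R : realType) (T : Type) (F : set_system T) {FF : ProperFilter F}
    (f g : T -> R) (k l : R) :
  f x @[x --> F] --> k -> g x @[x --> F] --> l ->
  ((f x +i* g x : R[i]^o) @[x --> F]) --> (k +i* l : R[i]^o).
Proof.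
move=> /cvgrPdist_le fk /cvgrPdist_le gl; apply/cvgrPdist_le => e e0.
case: e e0 => u v; rewrite ltcE /= => /andP[/eqP -> u0].
have u2 : 0 < u / 2 by rewrite divr_gt0.
near=> x; rewrite normc_def lecE /= eqxx /= -[leRHS](ger0_norm (ltW u0)) -sqrtr_sqr.
apply: ler_wsqrtr.
have sq (a : R) : `|a| <= u / 2 -> a ^+ 2 <= (u / 2) ^+ 2.
  by move=> h; rewrite -[a ^+ 2]real_normK ?num_real// ler_sqr ?nnegrE// ltW.
have hf : (k - f x) ^+ 2 <= (u / 2) ^+ 2 by apply: sq; near: x; exact: fk.
have hg : (l - g x) ^+ 2 <= (u / 2) ^+ 2 by apply: sq; near: x; exact: gl.
apply: (le_trans (lerD hf hg)).
have := sqr_ge0 u; have -> : (u / 2) ^+ 2 + (u / 2) ^+ 2 = u ^+ 2 / 2 by field.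
lra.
Unshelve. all: by end_near. Qed.

Section StringEnd.
Variables (R : realType) (S : krein_string R).
Local Notation L := (slen S).

Lemma near_string_end (x0 : R) : (x0%:E < L)%E ->
  \forall x \near string_end S, [/\ x0 < x, 0 <= x & (x%:E < L)%E].
Proof.
rewrite /string_end; have := slen_gt0 S; case: (slen S) => [l|_ _|//].
  rewrite !lte_fin => l0 x0l.
  near=> x; split.
  - near: x; exact: nbhs_left_gt.
  - by apply/ltW; near: x; exact: nbhs_left_gt.
  - by rewrite lte_fin; near: x; exact: nbhs_left_lt.
near=> x; split.
- near: x; apply: nbhs_pinfty_gt; exact: num_real.
- near: x; apply: nbhs_pinfty_ge; exact: num_real.
- exact: ltry.
Unshelve. all: by end_near. Qed.

Global Instance string_end_proper : ProperFilter (string_end S).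
Proof.
rewrite /string_end; have := slen_gt0 S; case: (slen S) => [l _|_|//].
  exact: at_left_proper_filter.
exact: proper_pinfty_nbhs.
Qed.

Lemma cvg_string_end (f : R -> R) :
  (forall e, 0 < e -> exists2 x0, (x0%:E < L)%E &
    exists c, forall x, x0 <= x -> 0 <= x -> (x%:E < L)%E -> `|f x - c| <= e) ->
  cvg (f x @[x --> string_end S]).
Proof.
move=> h; apply/cauchy_cvgP; apply: cauchy_exP => e e0.
have e2 : 0 < e / 2 by lra.
have [x0 x0L [c hc]] := h _ e2.
exists c; apply: filterS (near_string_end x0L) => x [x0x x_ge0 xL].
rewrite /ball /= distrC; apply: le_lt_trans (hc _ (ltW x0x) x_ge0 xL) _.
by lra.
Qed.

End StringEnd.

(** * Convergence of the Weyl quotients *)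

Section WeylFunction.
Variables (R : realType) (S : krein_string R) (r : R) (phi1 phi2 psi1 psi2 : R -> R).
Local Notation m := (smass S).
Local Notation L := (slen S).
Local Notation J X f := (\int[m]_(t in `[0%R, X]) f t).
Local Notation bmi X := (bmfun (`[0, X]%classic : set (measurableTypeR R))).
Local Notation w1 := (weyl_re phi1 phi2 psi1 psi2).
Local Notation w2 := (weyl_im phi1 phi2 psi1 psi2).
Local Notation P := (phi_energy S phi1 phi2).
Local Notation M := (mass S).
Hypothesis r0 : 0 < r.
Hypothesis sol_phi : forall X, 0 <= X -> (X%:E < L)%E ->
  string_system m X r 1 0 0 phi1 phi2.
Hypothesis sol_psi : forall X, 0 <= X -> (X%:E < L)%E ->
  string_system m X r 0 1 0 psi1 psi2.
Variable x0 : R.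
Hypotheses (x0_ge0 : 0 <= x0) (x0L : (x0%:E < L)%E) (Mx0 : 0 < M x0).

Let ge0_end X : x0 <= X -> 0 <= X. Proof. exact: le_trans. Qed.

Lemma mass_gt0 X : x0 <= X -> (X%:E < L)%E -> 0 < M X.
Proof. by move=> x0X XL; apply: lt_le_trans Mx0 _; exact: mass_nondecreasing. Qed.

Let a X t := w1 X * phi1 t - w2 X * phi2 t - psi1 t.
Let b X t := w1 X * phi2 t + w2 X * phi1 t - psi2 t.

Let bma X Y : 0 <= Y -> (Y%:E < L)%E -> bmi Y (a X).
Proof. by move=> Y0 YL; have [] := weyl_system sol_phi sol_psi Y0 YL (w1 X) (w2 X). Qed.

Let bmb X Y : 0 <= Y -> (Y%:E < L)%E -> bmi Y (b X).
Proof. by move=> Y0 YL; have [] := weyl_system sol_phi sol_psi Y0 YL (w1 X) (w2 X). Qed.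

Lemma weyl_dirichlet X : x0 <= X -> (X%:E < L)%E ->
  [/\ string_system m X r (w1 X) (-1) (w2 X) (a X) (b X), a X X = 0 & b X X = 0].
Proof.
move=> x0X XL; have X0 := ge0_end x0X.
have [? ?] := weyl_vanish psi1 psi2 sol_phi X0 XL (mass_gt0 x0X XL).
by split=> //; exact: weyl_system.
Qed.

Lemma weyl_energy_le Y X : 0 <= Y -> Y <= X -> x0 <= X -> (X%:E < L)%E ->
  J Y (fun t => a X t ^+ 2) + J Y (fun t => b X t ^+ 2) <= w2 X / r.
Proof.
move=> Y0 YX x0X XL; have X0 := ge0_end x0X.
have [sys aX bX] := weyl_dirichlet x0X XL.
rewrite -(dirichlet_energy X0 (string_fin XL) sys aX bX) mulrAC mulfV ?lt0r_neq0// mul1r.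
by apply: lerD; apply: Rintegral_le_itv => //;
  try (by move=> t; exact: sqr_ge0); apply: bmfunX; [exact: bma|exact: bmb].
Qed.

Lemma weyl_im_ge0 X : x0 <= X -> (X%:E < L)%E -> 0 <= w2 X.
Proof.
move=> x0X XL; have [sys aX bX] := weyl_dirichlet x0X XL.
exact: (dirichlet_ge0 (ge0_end x0X) (string_fin XL) r0 sys aX bX).
Qed.

(** On the fixed interval [[0, x0]] the number [q] is recovered from [y = q phi - psi]
    by the integral equation. Averaging over [[0, x0]] and bounding [|y|^2] by the
    energy identity gives [|q|^2 <= A + C * Im q]. *)
Lemma weyl_bounded : exists B, forall X, x0 <= X -> (X%:E < L)%E ->
  `|w1 X| <= B /\ `|w2 X| <= B.
Proof.
set A := 3 * x0 ^+ 2; set C := 3 / (r * M x0) + 6 * r * x0 ^+ 2 * M x0.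
have A0 : 0 <= A by rewrite mulr_ge0 ?sqr_ge0.
have C0 : 0 <= C.
  by rewrite addr_ge0 ?divr_ge0 ?mulr_ge0 ?sqr_ge0 ?(ltW r0) ?(ltW Mx0).
exists (1 + A + C) => X x0X XL; have X0 := ge0_end x0X.
have fin := string_fin x0L; have mD := itv_measurable x0.
have q0 := weyl_im_ge0 x0X XL.
have ha := bma X x0_ge0 x0L; have hb := bmb X x0_ge0 x0L.
set q1 := w1 X in q0 *; set q2 := w2 X in q0 *.
have hs := weyl_energy_le x0_ge0 x0X x0X XL; rewrite -/q2 in hs.
set sa := J x0 (fun t => a X t ^+ 2) in hs; set sb := J x0 (fun t => b X t ^+ 2) in hs.
have sa0 : 0 <= sa by apply: Rintegral_ge0 => t _; exact: sqr_ge0.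
have sb0 : 0 <= sb by apply: Rintegral_ge0 => t _; exact: sqr_ge0.
have rampI (f : R -> R) x : bmi x0 f -> 0 <= x <= x0 ->
    J x0 (fun t => ramp x t * f t) ^+ 2 <= x0 ^+ 2 * M x0 * J x0 (fun t => f t ^+ 2).
  move=> hf /andP[x_ge0 xx0]; have hramp := bmfun_ramp x0_ge0 x.
  apply: le_trans (bmint_CS mD fin hramp hf) _.
  rewrite ler_wpM2r//; first by apply: Rintegral_ge0 => t _; exact: sqr_ge0.
  rewrite /mass -bmintZ; [|bmside..].
  apply: bmint_le => //; [by bmt|by bmt|move=> t].
  rewrite /= in_itv/= => /andP[t0 tx0]; rewrite mulr1 ler_sqr ?nnegrE ?ramp_ge0//.
  by rewrite /ramp; case: (leP x t) => ?; lra.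
have pt x : 0 <= x <= x0 -> q1 ^+ 2 + q2 ^+ 2 <=
    3 * (a X x ^+ 2 + b X x ^+ 2) + (A + 6 * (r ^+ 2 * x0 ^+ 2 * M x0) * (q2 / r)).
  move=> xx0; have /andP[x_ge0 xlex0] := xx0.
  have [_ _ /(_ _ xx0)[]] := weyl_system sol_phi sol_psi x0_ge0 x0L q1 q2.
  rewrite -/(a X) -/(b X) -/(a X x) -/(b X x).
  have := rampI _ _ ha xx0; have := rampI _ _ hb xx0.
  rewrite -/sa -/sb.
  set Ia := J x0 (fun t => ramp x t * a X t); set Ib := J x0 (fun t => ramp x t * b X t).
  move=> hIb hIa ea eb.
  have hx : x ^+ 2 <= x0 ^+ 2 by rewrite ler_sqr ?nnegrE.
  have -> : q1 = a X x + x - r * Ib by rewrite ea; ring.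
  have e2 : q2 = b X x + r * Ia by rewrite eb; ring.
  have k0 : 0 <= 6 * (r ^+ 2 * x0 ^+ 2 * M x0).
    by rewrite mulr_ge0// mulr_ge0 ?(ltW Mx0)// mulr_ge0 ?sqr_ge0.
  have h1 := ler_wpM2l k0 hs.
  have h2 := ler_wpM2l (sqr_ge0 r) hIa.
  have h3 := ler_wpM2l (sqr_ge0 r) hIb.
  have j1 : (a X x + x - r * Ib) ^+ 2 <= 3 * (a X x ^+ 2 + x ^+ 2 + r ^+ 2 * Ib ^+ 2).
    rewrite -subr_ge0 [leRHS](_ : _ = (a X x - x) ^+ 2 + (a X x + r * Ib) ^+ 2
      + (x + r * Ib) ^+ 2) ?addr_ge0 ?sqr_ge0//; ring.
  have j2 : q2 ^+ 2 <= 3 * (b X x ^+ 2 + r ^+ 2 * Ia ^+ 2).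
    rewrite e2 -subr_ge0 [leRHS](_ : _ = (b X x - r * Ia) ^+ 2 + b X x ^+ 2
      + (r * Ia) ^+ 2) ?addr_ge0 ?sqr_ge0//; ring.
  rewrite /A; nra.
have key : q1 ^+ 2 + q2 ^+ 2 <= A + C * q2.
  move: (q1 ^+ 2 + q2 ^+ 2) pt => q pt.
  have /(bmint_le mD fin) : forall x, `[0, x0]%classic x -> (fun=> q) x <=
      3 * (a X x ^+ 2 + b X x ^+ 2) + (A + 6 * (r ^+ 2 * x0 ^+ 2 * M x0) * (q2 / r)).
    by move=> x; rewrite /= in_itv/=; exact: pt.
  move=> /(_ ltac:(by bmt) ltac:(by bmt)).
  rewrite bmintD; [|bmside..]; rewrite bmintZ; [|bmside..].
  rewrite bmintD; [|bmside..]; rewrite -/sa -/sb /=.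
  have Jc c : J x0 (fun=> c) = c * M x0.
    rewrite /mass -bmintZ; [|bmside..]; by apply: eq_Rintegral => t _; rewrite mulr1.
  rewrite !Jc => h.
  rewrite -(ler_pM2r Mx0); apply: le_trans h _.
  have -> : (A + C * q2) * M x0 =
      3 * (q2 / r) + (A + 6 * (r ^+ 2 * x0 ^+ 2 * M x0) * (q2 / r)) * M x0.
    by rewrite /C; field; rewrite !lt0r_neq0.
  by rewrite lerD2r ler_pM2l.
have q2B : q2 <= 1 + A + C.
  rewrite leNgt; apply/negP => h.
  have := sqr_ge0 q1; nra.
split; last by rewrite ger0_norm.
apply: normr_le_of_sqr_le; first by rewrite addr_ge0// addr_ge0.
have := sqr_ge0 q2; nra.
Qed.

(** On [[0, X]] the difference of the solutions vanishing at [Y] and at [X] is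
    [(q_Y - q_X) phi]; both solutions have bounded energy. This is Weyl's estimate
    of the radius of the limit circle. *)
Lemma weyl_contraction X Y : x0 <= X -> X <= Y -> (Y%:E < L)%E ->
  ((w1 Y - w1 X) ^+ 2 + (w2 Y - w2 X) ^+ 2) * P X <= 2 * (w2 X + w2 Y) / r.
Proof.
move=> x0X XY YL; have X0 := ge0_end x0X.
have XL : (X%:E < L)%E by apply: le_lt_trans YL; rewrite lee_fin.
have fin := string_fin XL; have mD := itv_measurable X.
have haX := bma X X0 XL; have hbX := bmb X X0 XL.
have haY := bma Y X0 XL; have hbY := bmb Y X0 XL.
have eX := weyl_energy_le X0 (lexx X) x0X XL.
have eY := weyl_energy_le X0 XY (le_trans x0X XY) YL.
have hn := bmfun_phi_norm2 sol_phi X0 XL.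
rewrite /phi_energy -bmintZ; [|bmside..].
apply: (@le_trans _ _ (2 * ((J X (fun t => a X t ^+ 2) + J X (fun t => b X t ^+ 2)) +
    (J X (fun t => a Y t ^+ 2) + J X (fun t => b Y t ^+ 2))))); last first.
  rewrite -mulrA ler_pM2l// mulrDl; exact: lerD.
rewrite -!bmintD; [|bmside..]; rewrite -bmintZ; [|bmside..].
apply: bmint_le => //; [by bmt|by bmt|move=> t _].
rewrite -subr_ge0 [leRHS](_ : _ = (a Y t + a X t) ^+ 2 + (b Y t + b X t) ^+ 2).
  by rewrite addr_ge0 ?sqr_ge0.
by rewrite /a /b /phi_norm2; ring.
Qed.

Lemma weyl_cvg_unbounded :
  (forall N, exists X, [/\ 0 <= X, (X%:E < L)%E & N < P X]) ->
  cvg (w1 x @[x --> string_end S]) /\ cvg (w2 x @[x --> string_end S]).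
Proof.
move=> unb; have [B hB] := weyl_bounded.
suff h e : 0 < e -> exists2 y, (y%:E < L)%E & forall x, y <= x -> 0 <= x -> (x%:E < L)%E ->
    `|w1 x - w1 y| <= e /\ `|w2 x - w2 y| <= e.
  split; apply: cvg_string_end => e /h[y yL hy]; exists y => //.
    by exists (w1 y) => x yx xx xL; case: (hy x yx xx xL).
  by exists (w2 y) => x yx xx xL; case: (hy x yx xx xL).
move=> e0; have [X [X_ge0 XL hN]] := unb (4 * B / r / e ^+ 2).
have yL : ((Num.max x0 X)%:E < L)%E by case: (leP x0 X).
exists (Num.max x0 X) => // x yx xx xL.
set y := Num.max x0 X in yL yx *.
have x0y : x0 <= y by rewrite /y le_max lexx.
have Py : 4 * B / r / e ^+ 2 < P y.
  apply: lt_le_trans hN _; apply: (phi_energy_nondecreasing sol_phi) => //.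
  by rewrite /y le_max lexx orbT.
have := weyl_contraction x0y yx xL.
have [_ By] := hB _ x0y yL; have [_ Bx] := hB _ (le_trans x0y yx) xL.
set d1 := w1 x - w1 y; set d2 := w2 x - w2 y => h.
have dle : d1 ^+ 2 + d2 ^+ 2 <= e ^+ 2.
  rewrite leNgt; apply/negP => hlt.
  have e2 : 0 < e ^+ 2 by rewrite exprn_gt0.
  have B0 : 0 <= B by apply: le_trans (normr_ge0 _) By.
  have K0 : 0 <= 4 * B / r / e ^+ 2.
    by rewrite mulr_ge0 ?invr_ge0 ?sqr_ge0// divr_ge0 ?(ltW r0)// mulr_ge0.
  have : 4 * B / r < (d1 ^+ 2 + d2 ^+ 2) * P y.
    rewrite -[ltLHS](divfK (lt0r_neq0 e2)) mulrC.
    apply: (@le_lt_trans _ _ ((d1 ^+ 2 + d2 ^+ 2) * (4 * B / r / e ^+ 2))).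
      by rewrite ler_wpM2r// ltW.
    by rewrite ltr_pM2l// (lt_trans e2).
  apply/negP; rewrite -leNgt; apply: le_trans h _.
  rewrite ler_pM2r ?invr_gt0//.
  have := ler_norm (w2 y); have := ler_norm (w2 x); lra.
split; apply: (normr_le_of_sqr_le (ltW e0)); apply: le_trans dle; rewrite ?lerDl ?lerDr; exact: sqr_ge0.
Qed.

(** As [|phi(x)|^2 >= P(x) / M(x)] by [phi_energy_le], the energy grows by a factor
    [3 / 2] each time the mass doubles, in the manner of the Abel-Dini theorem. *)
Lemma mass_bounded N : (forall X, 0 <= X -> (X%:E < L)%E -> P X <= N) ->
  exists N', forall X, 0 <= X -> (X%:E < L)%E -> M X <= N'.
Proof.
move=> PN; apply: contrapT => /forallNP unb.
pose E := [set P X | X in [set X | 0 <= X /\ (X%:E < L)%E]].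
have E_x0 : E (P x0) by exists x0.
have supE : has_sup E.
  by split; [exists (P x0)|exists N => _ [X [X0 XL] <-]; exact: PN].
have P_le X : 0 <= X -> (X%:E < L)%E -> P X <= sup E.
  by move=> X0 XL; apply: ub_le_sup; [exact: supE.2|exists X].
have s0 : 0 < sup E.
  apply: lt_le_trans (P_le _ x0_ge0 x0L); exact: (phi_energy_gt0 sol_phi).
have [|_ [X [X0 XL] <-] hX] := sup_adherent (_ : 0 < sup E / 4) supE.
  by lra.
have [Y [Y0 YL MY]] : exists Y, [/\ 0 <= Y, (Y%:E < L)%E & 2 * M X + 1 < M Y].
  have /existsNP[Y /not_implyP[Y0 /not_implyP[YL /negP]]] := unb (2 * M X + 1).
  by rewrite -ltNge => MY; exists Y.
have MX0 : 0 <= M X by exact: mass_ge0.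
have XY : X <= Y.
  rewrite leNgt; apply/negP => YX.
  by have := mass_nondecreasing (ltW YX) XL; lra.
have MY0 : 0 < M Y by lra.
have fin := string_fin YL; have mD := itv_measurable Y.
have hn := bmfun_phi_norm2 sol_phi Y0 YL.
have ht : bmi Y (fun t : R => (t <= X)%R%:R : R) by exact: bmfun_le.
suff : P X / M Y * (M Y - M X) <= P Y - P X.
  rewrite mulrBr divfK ?lt0r_neq0//.
  have := P_le _ Y0 YL.
  have : P X / M Y * M X <= P X / 2.
    rewrite -mulrA ler_wpM2l ?phi_energy_ge0//.
    by rewrite mulrC ler_pdivrMr//; lra.
  lra.
have -> : P Y - P X = J Y (fun t => phi_norm2 phi1 phi2 t
    - (t <= X)%R%:R * phi_norm2 phi1 phi2 t).
  by rewrite /phi_energy (Rintegral_restrict S _ XY) bmintB; [|bmside..].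
have -> : M Y - M X = J Y (fun t => 1 - (t <= X)%R%:R * 1).
  by rewrite /mass (Rintegral_restrict S _ XY) bmintB; [|bmside..].
rewrite -bmintZ; [|bmside..].
apply: bmint_le => //; [by bmt|by bmt|move=> t].
rewrite /= in_itv/= => /andP[t0 tY].
have [tX|Xt] := leP t X; first by rewrite !mul1r !subrr mulr0.
have tL : (t%:E < L)%E by apply: le_lt_trans YL; rewrite lee_fin.
rewrite !mul0r !subr0 mulr1 ler_pdivrMr//.
apply: (@le_trans _ _ (P t)); first exact: (phi_energy_nondecreasing sol_phi (ltW Xt) tL).
apply: le_trans (phi_energy_le sol_phi t0 tL) _.
by rewrite ler_wpM2l ?phi_norm2_ge0//; exact: mass_nondecreasing.
Qed.

End WeylFunction.

Section BoundedSystem.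
Variables (R : realType) (S : krein_string R) (r : R).
Local Notation m := (smass S).
Local Notation L := (slen S).
Local Notation J X f := (\int[m]_(t in `[0%R, X]) f t).
Local Notation bmi X := (bmfun (`[0, X]%classic : set (measurableTypeR R))).

Definition locally_bmfun (f : R -> R) := forall X, 0 <= X -> (X%:E < L)%E -> bmi X f.

Lemma Rintegral_tail_small (f : R -> R) N : locally_bmfun f ->
  (forall X, 0 <= X -> (X%:E < L)%E -> J X (fun t => `|f t|) <= N) ->
  forall e, 0 < e -> exists X, [/\ 0 <= X, (X%:E < L)%E &
    forall Y, X <= Y -> (Y%:E < L)%E ->
      J Y (fun t => `|f t|) - J X (fun t => `|f t|) <= e].
Proof.
move=> hf fN e e0.
pose E := [set J X (fun t => `|f t|) | X in [set X | 0 <= X /\ (X%:E < L)%E]].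
have supE : has_sup E.
  split; last by exists N => _ [X [X0 XL] <-]; exact: fN.
  by exists (J 0 (fun t => `|f t|)), 0 => //; split=> //; exact: slen_gt0.
have [_ [X [X0 XL] <-] hX] := sup_adherent e0 supE.
exists X; split=> // Y XY YL.
have : J Y (fun t => `|f t|) <= sup E.
  by apply: ub_le_sup; [exact: supE.2|exists Y => //; split=> //; exact: le_trans XY].
lra.
Qed.

Lemma Rintegral_cvg (f : R -> R) N : locally_bmfun f ->
  (forall X, 0 <= X -> (X%:E < L)%E -> J X (fun t => `|f t|) <= N) ->
  cvg (J x f @[x --> string_end S]).
Proof.
move=> hf fN; apply: cvg_string_end => e e0.
have [X [X0 XL hX]] := Rintegral_tail_small hf fN e0.
exists X => //; exists (J X f) => Y XY Y0 YL.
by apply: le_trans (Rintegral_tail_le XY YL (hf _ Y0 YL)) _; exact: hX.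
Qed.

(** The part of the integral over [[0, X]] is at most [X * N / x], the rest at most
    the tail of the integral of [|f|]. *)
Lemma Rintegral_moment_small (f : R -> R) N : L = +oo%E -> locally_bmfun f ->
  (forall X, 0 <= X -> (X%:E < L)%E -> J X (fun t => `|f t|) <= N) ->
  (J x (fun t => t * f t) / x @[x --> string_end S]) --> 0.
Proof.
move=> Loo hf fN; apply/cvgrPdist_le => e e0.
have N0 : 0 <= N.
  by apply: le_trans (fN 0 _ _) => //; [exact: Rintegral_ge0|exact: slen_gt0].
have e2 : 0 < e / 2 by lra.
have [X [X0 XL hX]] := Rintegral_tail_small hf fN e2.
have big : (((X + 1) * (2 * N / e + 1))%:E < L)%E by rewrite Loo ltry.
have q0 : 0 <= 2 * N / e by rewrite divr_ge0 ?mulr_ge0// ltW.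
apply: filterS (near_string_end big) => Y [YX Y0 YL].
have XleY : X <= Y.
  apply: le_trans (ltW YX); nra.
have Y_gt0 : 0 < Y by apply: lt_le_trans (ltW YX); rewrite mulr_gt0//; lra.
have fin := string_fin YL; have mD := itv_measurable Y.
have hY := hf _ Y0 YL; have hn := bmfun_norm hY; have hid := bmfun_id Y.
have ht : bmi Y (fun t : R => (t <= X)%R%:R : R) by exact: bmfun_le.
rewrite sub0r normrN normrM [X in _ * X]gtr0_norm ?invr_gt0// ler_pdivrMr//.
have htf : bmi Y (fun t => t * f t) by bmt; exact: hid.
apply: le_trans (le_normr_Rintegral mD (bmfun_integrable mD fin htf)) _.
apply: (@le_trans _ _ (X * J X (fun t => `|f t|)
    + Y * (J Y (fun t => `|f t|) - J X (fun t => `|f t|)))); last first.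
  have h1 := hX _ XleY YL.
  have h2 := fN _ X0 XL.
  have h3 : X * J X (fun t => `|f t|) <= e / 2 * Y.
    apply: (@le_trans _ _ (X * N)); first by rewrite ler_wpM2l.
    have := ler_wpM2l (ltW e2) (ltW YX).
    have -> : e / 2 * ((X + 1) * (2 * N / e + 1)) = (X + 1) * N + e / 2 * (X + 1).
      by field; rewrite lt0r_neq0.
    have : 0 <= e / 2 * (X + 1) by rewrite mulr_ge0 ?(ltW e2) ?addr_ge0.
    by lra.
  have := ler_wpM2l Y0 h1; lra.
rewrite !(Rintegral_restrict S _ XleY) -bmintB; [|bmside..].
rewrite -!bmintZ; [|bmside..]; rewrite -bmintD; [|bmside..].
apply: bmint_le; [exact: mD|exact: fin|exact: bmfun_norm|by bmt|move=> t].
rewrite /= in_itv/= => /andP[t0 tY]; rewrite normrM ger0_norm//.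
have [tX|Xt] := leP t X.
  by rewrite !mul1r subrr mulr0 addr0 ler_wpM2r.
by rewrite !mul0r subr0 mulr0 add0r ler_wpM2r.
Qed.

Variables (alpha beta gamma : R) (a b : R -> R) (N : R).
Hypothesis sol : forall X, 0 <= X -> (X%:E < L)%E ->
  string_system m X r alpha beta gamma a b.
Hypothesis aN : forall X, 0 <= X -> (X%:E < L)%E -> J X (fun t => `|a t|) <= N.
Hypothesis bN : forall X, 0 <= X -> (X%:E < L)%E -> J X (fun t => `|b t|) <= N.

Let la : locally_bmfun a. Proof. by move=> X X0 XL; case: (sol X0 XL). Qed.
Let lb : locally_bmfun b. Proof. by move=> X X0 XL; case: (sol X0 XL). Qed.

(** At the end of its own interval the ramp is [x - t], which separates the two
    integrals whose limits exist. *)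
Lemma system_at x : 0 <= x -> (x%:E < L)%E ->
  a x = alpha + beta * x + r * (x * J x b - J x (fun t => t * b t)) /\
  b x = gamma - r * (x * J x a - J x (fun t => t * a t)).
Proof.
move=> x0 xL; have fin := string_fin xL; have mD := itv_measurable x.
have ha := la x0 xL; have hb := lb x0 xL; have hid := bmfun_id x.
have E (f : R -> R) : bmi x f ->
    J x (fun t => ramp x t * f t) = x * J x f - J x (fun t => t * f t).
  move=> hf; have htf : bmi x (fun t => t * f t) by bmt; exact: hid.
  rewrite -bmintZ; [|bmside..]; rewrite -bmintB; [|bmside..].
  apply: eq_Rintegral => t; rewrite inE => xt.
  by rewrite (rampX xt); ring.
have [_ _ /(_ x)[|-> ->]] := sol x0 xL; first by rewrite x0 lexx.
by rewrite !E.
Qed.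

Lemma system_cvg_finite l : L = l%:E ->
  cvg (a x @[x --> string_end S]) /\ cvg (b x @[x --> string_end S]).
Proof.
move=> Ll.
have l0 : 0 < l by have := slen_gt0 S; rewrite Ll lte_fin.
have cx : x @[x --> string_end S] --> l.
  rewrite /string_end Ll; exact: cvg_at_left_filter.
have moment (f : R -> R) : locally_bmfun f ->
    (forall X, 0 <= X -> (X%:E < L)%E -> J X (fun t => `|f t|) <= N) ->
    cvg (J x (fun t => t * f t) @[x --> string_end S]).
  move=> lf fN; apply: (@Rintegral_cvg _ (l * N)) => [X X0 XL|X X0 XL].
    by apply: bmfunM; [exact: bmfun_id|exact: lf].
  have fin := string_fin XL; have mD := itv_measurable X.
  have hn := bmfun_norm (lf _ X0 XL).
  apply: (@le_trans _ _ (l * J X (fun t => `|f t|))); last by rewrite ler_wpM2l ?fN// ltW.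
  rewrite -bmintZ; [|bmside..].
  have htf : bmi X (fun t => t * f t) by apply: bmfunM; [exact: bmfun_id|exact: lf].
  apply: bmint_le => //; [exact: bmfun_norm|by bmt|move=> t].
  rewrite /= in_itv/= => /andP[t0 tX]; rewrite normrM ler_wpM2r// ger0_norm//.
  by apply: le_trans tX _; move: XL; rewrite Ll lte_fin => /ltW.
have ev := near_string_end (slen_gt0 S).
split.
- apply: (cvgP (alpha + beta * l + r * (l * lim (J x b @[x --> string_end S])
      - lim (J x (fun t => t * b t) @[x --> string_end S])))).
  apply: (@cvg_near_eq _ _ _ _ _ (fun x => alpha + beta * x
      + r * (x * J x b - J x (fun t => t * b t)))).
    by apply: filterS ev => x [_ x0 xL]; have [-> _] := system_at x0 xL.
  apply: cvgD; first by apply: cvgD; [exact: cvg_cst|apply: cvgM; [exact: cvg_cst|]].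
  apply: cvgM; first exact: cvg_cst.
  apply: cvgB; last exact: moment lb bN.
  by apply: cvgM => //; exact: Rintegral_cvg lb bN.
- apply: (cvgP (gamma - r * (l * lim (J x a @[x --> string_end S])
      - lim (J x (fun t => t * a t) @[x --> string_end S])))).
  apply: (@cvg_near_eq _ _ _ _ _ (fun x => gamma - r * (x * J x a - J x (fun t => t * a t)))).
    by apply: filterS ev => x [_ x0 xL]; have [_ ->] := system_at x0 xL.
  apply: cvgB; first exact: cvg_cst.
  apply: cvgM; first exact: cvg_cst.
  apply: cvgB; last exact: moment la aN.
  by apply: cvgM => //; exact: Rintegral_cvg la aN.
Qed.

(** On an infinite string integrable solutions grow at most linearly, because
    their slopes converge. *)
Lemma system_cvg_infinite : L = +oo%E ->
  (a x / x @[x --> string_end S]) --> beta + r * lim (J x b @[x --> string_end S]) /\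
  (b x / x @[x --> string_end S]) --> - (r * lim (J x a @[x --> string_end S])).
Proof.
move=> Loo; have ev := near_string_end (slen_gt0 S).
have ci c : (c / x @[x --> string_end S]) --> 0.
  apply/cvgrPdist_le => e e0.
  have big : ((`|c| / e)%:E < L)%E by rewrite Loo ltry.
  apply: filterS2 (near_string_end big) ev => x [cx _ _] [x0 _ _].
  rewrite sub0r normrN normrM [X in _ * X]gtr0_norm ?invr_gt0// ler_pdivrMr//.
  by rewrite mulrC -ler_pdivrMr// ltW.
split.
- have -> : beta + r * lim (J x b @[x --> string_end S]) =
      0 + beta + r * (lim (J x b @[x --> string_end S]) - 0) by rewrite add0r subr0.
  apply: (@cvg_near_eq _ _ _ _ _ (fun x => alpha / x + beta
      + r * (J x b - J x (fun t => t * b t) / x))).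
    apply: filterS ev => x [x_gt0 x0 xL]; have [-> _] := system_at x0 xL.
    by field; rewrite lt0r_neq0.
  apply: cvgD; first by apply: cvgD; [exact: ci|exact: cvg_cst].
  apply: cvgM; first exact: cvg_cst.
  apply: cvgB; first exact: Rintegral_cvg lb bN.
  exact: Rintegral_moment_small Loo lb bN.
- have -> : - (r * lim (J x a @[x --> string_end S])) =
      0 - r * (lim (J x a @[x --> string_end S]) - 0) by rewrite sub0r subr0.
  apply: (@cvg_near_eq _ _ _ _ _ (fun x => gamma / x
      - r * (J x a - J x (fun t => t * a t) / x))).
    apply: filterS ev => x [x_gt0 x0 xL]; have [_ ->] := system_at x0 xL.
    by field; rewrite lt0r_neq0.
  apply: cvgB; first exact: ci.
  apply: cvgM; first exact: cvg_cst.
  apply: cvgB; first exact: Rintegral_cvg la aN.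
  exact: Rintegral_moment_small Loo la aN.
Qed.

End BoundedSystem.

Section WeylConvergence.
Variables (R : realType) (S : krein_string R) (r : R) (phi1 phi2 psi1 psi2 : R -> R).
Local Notation m := (smass S).
Local Notation L := (slen S).
Local Notation J X f := (\int[m]_(t in `[0%R, X]) f t).
Local Notation w1 := (weyl_re phi1 phi2 psi1 psi2).
Local Notation w2 := (weyl_im phi1 phi2 psi1 psi2).
Local Notation P := (phi_energy S phi1 phi2).
Local Notation M := (mass S).
Hypothesis r0 : 0 < r.
Hypothesis sol_phi : forall X, 0 <= X -> (X%:E < L)%E ->
  string_system m X r 1 0 0 phi1 phi2.
Hypothesis sol_psi : forall X, 0 <= X -> (X%:E < L)%E ->
  string_system m X r 0 1 0 psi1 psi2.

Lemma weyl_cvg_scaled (s : R -> R) (u1 u2 v1 v2 : R) :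
  (\forall x \near string_end S, s x != 0) ->
  (phi1 x / s x @[x --> string_end S] --> u1) ->
  (phi2 x / s x @[x --> string_end S] --> u2) ->
  (psi1 x / s x @[x --> string_end S] --> v1) ->
  (psi2 x / s x @[x --> string_end S] --> v2) ->
  u1 ^+ 2 + u2 ^+ 2 != 0 ->
  cvg (w1 x @[x --> string_end S]) /\ cvg (w2 x @[x --> string_end S]).
Proof.
move=> s0 hu1 hu2 hv1 hv2 u0.
have hn : ((phi1 x / s x) * (phi1 x / s x) + (phi2 x / s x) * (phi2 x / s x))^-1
    @[x --> string_end S] --> (u1 * u1 + u2 * u2)^-1.
  by apply: cvgV; [rewrite -!expr2|apply: cvgD; apply: cvgM].
have E x : s x != 0 ->
    (phi1 x / s x) * (phi1 x / s x) + (phi2 x / s x) * (phi2 x / s x) =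
    phi_norm2 phi1 phi2 x / (s x * s x).
  by move=> sx; rewrite /phi_norm2; field.
split.
- apply: (cvgP ((v1 * u1 + v2 * u2) * (u1 * u1 + u2 * u2)^-1)).
  apply: (@cvg_near_eq _ _ _ _ _ (fun x =>
    ((psi1 x / s x) * (phi1 x / s x) + (psi2 x / s x) * (phi2 x / s x)) *
    ((phi1 x / s x) * (phi1 x / s x) + (phi2 x / s x) * (phi2 x / s x))^-1)).
    apply: filterS s0 => x sx; rewrite E// invf_div /weyl_re.
    have [->|n0] := eqVneq (phi_norm2 phi1 phi2 x) 0; first by rewrite invr0 !mulr0.
    by field; rewrite sx n0.
  by apply: cvgM => //; apply: cvgD; apply: cvgM.
- apply: (cvgP ((v2 * u1 - v1 * u2) * (u1 * u1 + u2 * u2)^-1)).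
  apply: (@cvg_near_eq _ _ _ _ _ (fun x =>
    ((psi2 x / s x) * (phi1 x / s x) - (psi1 x / s x) * (phi2 x / s x)) *
    ((phi1 x / s x) * (phi1 x / s x) + (phi2 x / s x) * (phi2 x / s x))^-1)).
    apply: filterS s0 => x sx; rewrite E// invf_div /weyl_im.
    have [->|n0] := eqVneq (phi_norm2 phi1 phi2 x) 0; first by rewrite invr0 !mulr0.
    by field; rewrite sx n0.
  by apply: cvgM => //; apply: cvgB; apply: cvgM.
Qed.

Lemma Rintegral_norm_le X (f : R -> R) N N' : 0 <= X -> (X%:E < L)%E ->
  bmfun (`[0, X]%classic : set (measurableTypeR R)) f ->
  0 <= N' -> M X <= N -> J X (fun t => f t ^+ 2) <= N' ->
  J X (fun t => `|f t|) <= 1 + N * N'.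
Proof.
move=> X0 XL hf N'0 MN fN.
have N0 : 0 <= N by apply: le_trans MN; exact: mass_ge0.
have := Rintegral_sqr_le XL (bmfun_norm hf).
have -> : J X (fun t => `|f t| ^+ 2) = J X (fun t => f t ^+ 2).
  by apply: eq_Rintegral => t _; rewrite real_normK ?num_real.
set I := J X (fun t => `|f t|) => h.
have hI : I ^+ 2 <= N * N'.
  apply: le_trans h _; apply: ler_pM => //; first exact: mass_ge0.
  by apply: Rintegral_ge0 => t _; exact: sqr_ge0.
have := sqr_ge0 (I - 1); have I0 : 0 <= I by exact: Rintegral_ge0.
have : 0 <= N * N' by rewrite mulr_ge0.
nra.
Qed.

(** If the energy of [phi] is unbounded, [weyl_contraction] makes the quotients a
    Cauchy family. Otherwise the mass is finite and [phi] and [psi] are integrable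
    over the string. They then converge at a finite end, where [|phi|] stays away
    from zero by [phi_energy_le]; at an infinite end they converge after division
    by [x], and the limit of [phi / x] is not zero since its modulus is [r] times
    the square root of the limit of the nondecreasing positive function [slope2]. *)
Lemma weyl_cvg x0 : 0 <= x0 -> (x0%:E < L)%E -> 0 < M x0 ->
  cvg (w1 x @[x --> string_end S]) /\ cvg (w2 x @[x --> string_end S]).
Proof.
move=> x0_ge0 x0L Mx0.
have [[N PN]|unb] := pselect (exists N, forall X, 0 <= X -> (X%:E < L)%E -> P X <= N); last first.
  apply: (weyl_cvg_unbounded r0 sol_phi sol_psi x0_ge0 x0L Mx0) => N.
  apply: contrapT => h; apply: unb; exists N => X X0 XL.
  by rewrite leNgt; apply/negP => NP; apply: h; exists X.
have [N' MN] := mass_bounded sol_phi x0_ge0 x0L Mx0 PN.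
have [B hB] := weyl_bounded r0 sol_phi sol_psi x0_ge0 x0L Mx0.
have N0 : 0 <= N by apply: le_trans (PN _ x0_ge0 x0L); exact: phi_energy_ge0.
have h1 X : 0 <= X -> (X%:E < L)%E -> J X (fun t => phi1 t ^+ 2) <= N.
  move=> X0 XL; apply: le_trans (PN _ X0 XL); rewrite (phi_energyE sol_phi X0 XL) lerDl.
  by apply: Rintegral_ge0 => t _; exact: sqr_ge0.
have h2 X : 0 <= X -> (X%:E < L)%E -> J X (fun t => phi2 t ^+ 2) <= N.
  move=> X0 XL; apply: le_trans (PN _ X0 XL); rewrite (phi_energyE sol_phi X0 XL) lerDr.
  by apply: Rintegral_ge0 => t _; exact: sqr_ge0.
have B0 : 0 <= B by apply: le_trans (normr_ge0 _) (hB _ (lexx x0) x0L).1.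
pose N2 := 4 * (B ^+ 2 * N + B ^+ 2 * N + B / r).
have N2_ge0 : 0 <= N2.
  have BN : 0 <= B ^+ 2 * N by rewrite mulr_ge0 ?sqr_ge0.
  have Br : 0 <= B / r by rewrite divr_ge0 ?(ltW r0).
  by rewrite /N2; lra.
have sqB (x : R) : `|x| <= B -> x ^+ 2 <= B ^+ 2.
  by move=> xB; rewrite -[x ^+ 2]real_normK ?num_real// ler_sqr ?nnegrE.
(* psi = q phi - y is square integrable because phi and y are and q is bounded. *)
have hpsi X : x0 <= X -> (X%:E < L)%E ->
    J X (fun t => psi1 t ^+ 2) <= N2 /\ J X (fun t => psi2 t ^+ 2) <= N2.
  move=> x0X XL; have X0 := le_trans x0_ge0 x0X.
  have fin := string_fin XL; have mD := itv_measurable X.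
  have b1 := bmfun_phi1 sol_phi X0 XL; have b2 := bmfun_phi2 sol_phi X0 XL.
  have c1 := bmfun_psi1 sol_psi X0 XL; have c2 := bmfun_psi2 sol_psi X0 XL.
  have := weyl_energy_le r0 sol_phi sol_psi x0_ge0 Mx0 X0 (lexx X) x0X XL.
  have [B1 B2] := hB _ x0X XL; have := sqB _ B1; have := sqB _ B2.
  have := ler_norm (w2 X).
  set q1 := w1 X in B1 *; set q2 := w2 X in B2 * => q2n sq2 sq1.
  set A := J X (fun t => (q1 * phi1 t - q2 * phi2 t - psi1 t) ^+ 2).
  set C := J X (fun t => (q1 * phi2 t + q2 * phi1 t - psi2 t) ^+ 2) => hAC.
  have A0 : 0 <= A by apply: Rintegral_ge0 => t _; exact: sqr_ge0.
  have C0 : 0 <= C by apply: Rintegral_ge0 => t _; exact: sqr_ge0.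
  have q2r : q2 / r <= B / r by rewrite ler_pM2r ?invr_gt0//; lra.
  have I1 := h1 _ X0 XL; have I2 := h2 _ X0 XL.
  have I1_ge0 : 0 <= J X (fun t => phi1 t ^+ 2) by apply: Rintegral_ge0 => t _; exact: sqr_ge0.
  have I2_ge0 : 0 <= J X (fun t => phi2 t ^+ 2) by apply: Rintegral_ge0 => t _; exact: sqr_ge0.
  have k11 := ler_pM (sqr_ge0 q1) I1_ge0 sq1 I1.
  have k12 := ler_pM (sqr_ge0 q1) I2_ge0 sq1 I2.
  have k21 := ler_pM (sqr_ge0 q2) I1_ge0 sq2 I1.
  have k22 := ler_pM (sqr_ge0 q2) I2_ge0 sq2 I2.
  split.
  - apply: (@le_trans _ _ (4 * (q1 ^+ 2 * J X (fun t => phi1 t ^+ 2)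
        + q2 ^+ 2 * J X (fun t => phi2 t ^+ 2) + A))); last by rewrite /N2; lra.
    rewrite /A -!bmintZ; [|bmside..]; rewrite -!bmintD; [|bmside..].
    rewrite -bmintZ; [|bmside..].
    apply: bmint_le; [exact: mD|exact: fin|by bmt|by bmt|move=> t _].
    set y := _ - psi1 t; have -> : psi1 t = q1 * phi1 t - q2 * phi2 t - y by rewrite /y; ring.
    set c := q1 * phi1 t; set d := q2 * phi2 t.
    rewrite (_ : q1 ^+ 2 * phi1 t ^+ 2 = c ^+ 2); last by rewrite /c; ring.
    rewrite (_ : q2 ^+ 2 * phi2 t ^+ 2 = d ^+ 2); last by rewrite /d; ring.
    have := sqr_ge0 (c + d); have := sqr_ge0 (c + y); have := sqr_ge0 (d - y).
    have := sqr_ge0 c; have := sqr_ge0 d; have := sqr_ge0 y; nra.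
  - apply: (@le_trans _ _ (4 * (q1 ^+ 2 * J X (fun t => phi2 t ^+ 2)
        + q2 ^+ 2 * J X (fun t => phi1 t ^+ 2) + C))); last by rewrite /N2; lra.
    rewrite /C -!bmintZ; [|bmside..]; rewrite -!bmintD; [|bmside..].
    rewrite -bmintZ; [|bmside..].
    apply: bmint_le; [exact: mD|exact: fin|by bmt|by bmt|move=> t _].
    set y := _ - psi2 t; have -> : psi2 t = q1 * phi2 t + q2 * phi1 t - y by rewrite /y; ring.
    set c := q1 * phi2 t; set d := q2 * phi1 t.
    rewrite (_ : q1 ^+ 2 * phi2 t ^+ 2 = c ^+ 2); last by rewrite /c; ring.
    rewrite (_ : q2 ^+ 2 * phi1 t ^+ 2 = d ^+ 2); last by rewrite /d; ring.
    have := sqr_ge0 (c - d); have := sqr_ge0 (c + y); have := sqr_ge0 (d + y).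
    have := sqr_ge0 c; have := sqr_ge0 d; have := sqr_ge0 y; nra.
have hpsi' X : 0 <= X -> (X%:E < L)%E ->
    J X (fun t => psi1 t ^+ 2) <= N2 /\ J X (fun t => psi2 t ^+ 2) <= N2.
  move=> X0 XL; have [x0X|Xx0] := leP x0 X; first exact: hpsi.
  have [k1 k2] := hpsi _ (lexx x0) x0L.
  split; [apply: le_trans k1|apply: le_trans k2];
    apply: Rintegral_le_itv => //; try (by move=> t; exact: sqr_ge0);
    try exact: ltW; apply: bmfunX.
  - exact: (bmfun_psi1 sol_psi).
  - exact: (bmfun_psi2 sol_psi).
have p1N X : 0 <= X -> (X%:E < L)%E -> J X (fun t => `|phi1 t|) <= 1 + N' * N.
  move=> X0 XL; apply: (Rintegral_norm_le X0 XL (bmfun_phi1 sol_phi X0 XL)) => //; [exact: MN|exact: h1].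
have p2N X : 0 <= X -> (X%:E < L)%E -> J X (fun t => `|phi2 t|) <= 1 + N' * N.
  move=> X0 XL; apply: (Rintegral_norm_le X0 XL (bmfun_phi2 sol_phi X0 XL)) => //; [exact: MN|exact: h2].
have s1N X : 0 <= X -> (X%:E < L)%E -> J X (fun t => `|psi1 t|) <= 1 + N' * N2.
  move=> X0 XL; apply: (Rintegral_norm_le X0 XL (bmfun_psi1 sol_psi X0 XL)) => //; first exact: MN.
  exact: (hpsi' _ X0 XL).1.
have s2N X : 0 <= X -> (X%:E < L)%E -> J X (fun t => `|psi2 t|) <= 1 + N' * N2.
  move=> X0 XL; apply: (Rintegral_norm_le X0 XL (bmfun_psi2 sol_psi X0 XL)) => //; first exact: MN.
  exact: (hpsi' _ X0 XL).2.
have ev := near_string_end x0L.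
have : (exists l, L = l%:E) \/ L = +oo%E.
  by have := slen_gt0 S; case: (slen S) => [l _|_|//]; [left; exists l|right].
case=> [[l Ll]|Loo].
- have [cp1 cp2] := system_cvg_finite sol_phi p1N p2N Ll.
  have [cs1 cs2] := system_cvg_finite sol_psi s1N s2N Ll.
  have div1 (f : R -> R) : cvg (f x @[x --> string_end S]) ->
      (f x / 1 @[x --> string_end S] --> lim (f x @[x --> string_end S])).
    by move=> cf; under eq_fun do rewrite divr1.
  apply: (weyl_cvg_scaled (s := fun=> 1) _ (div1 _ cp1) (div1 _ cp2) (div1 _ cs1) (div1 _ cs2)).
    by apply: nearW => x; exact: oner_neq0.
  have Px0 : 0 < P x0 by exact: (phi_energy_gt0 sol_phi).
  have N'0 : 0 < N' by apply: lt_le_trans Mx0 (MN _ x0_ge0 x0L).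
  rewrite lt0r_neq0//; apply: (@lt_le_trans _ _ (P x0 / N')); first exact: divr_gt0.
  rewrite !expr2; apply: (@cvgr_to_ge _ (string_end S) _ _
    (fun x => phi1 x * phi1 x + phi2 x * phi2 x)).
    by apply: cvgD; apply: cvgM.
  apply: filterS ev => X [x0X X0 XL].
  rewrite ler_pdivrMr// -!expr2 -/(phi_norm2 phi1 phi2 X).
  apply: (@le_trans _ _ (P X)); first exact: (phi_energy_nondecreasing sol_phi (ltW x0X)).
  apply: le_trans (phi_energy_le sol_phi X0 XL) _.
  by rewrite ler_wpM2l ?phi_norm2_ge0// MN.
- have [cp1 cp2] := system_cvg_infinite sol_phi p1N p2N Loo.
  have [cs1 cs2] := system_cvg_infinite sol_psi s1N s2N Loo.
  apply: (weyl_cvg_scaled (s := id) _ cp1 cp2 cs1 cs2).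
    by apply: filterS ev => x [x0x _ _]; rewrite lt0r_neq0// (le_lt_trans x0_ge0).
  have s0 := slope2_gt0 sol_phi x0_ge0 x0L Mx0.
  set i1 := lim (J x phi1 @[x --> _]); set i2 := lim (J x phi2 @[x --> _]).
  have -> : (0 + r * i2) ^+ 2 + (- (r * i1)) ^+ 2 = r ^+ 2 * (i1 * i1 + i2 * i2) by ring.
  rewrite mulf_neq0 ?expf_neq0 ?lt0r_neq0//; apply: lt_le_trans s0 _.
  have l1 : locally_bmfun S phi1 by move=> X X0 XL; exact: (bmfun_phi1 sol_phi).
  have l2 : locally_bmfun S phi2 by move=> X X0 XL; exact: (bmfun_phi2 sol_phi).
  apply: (@cvgr_to_ge _ (string_end S) _ _
    (fun x => J x phi1 * J x phi1 + J x phi2 * J x phi2)).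
    by apply: cvgD; apply: cvgM; apply: Rintegral_cvg; eassumption.
  apply: filterS ev => X [x0X X0 XL].
  by rewrite -!expr2; exact: (slope2_nondecreasing sol_phi x0_ge0 (ltW x0X) XL).
Qed.

End WeylConvergence.

(** * The determinant delta and the truncation of the mass *)

Section Truncation.
Variables (R : realType) (S : krein_string R).
Local Notation m := (smass S).
Local Notation L := (slen S).
Local Notation J X f := (\int[m]_(t in `[0%R, X]) f t).
Local Notation bmi X := (bmfun (`[0, X]%classic : set (measurableTypeR R))).
Local Notation delta := (delta S).

(** The determinant [delta] of the measure with density [rho] on [[0, X]]. *)
Definition weight_delta (X : R) (rho : R -> R) :=
  J X rho * J X (fun t => rho t * t ^+ 2) - J X (fun t => rho t * t) ^+ 2.

(** The polarised determinant is the double integral of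
    [rho(x) nu(y) (x - y)^2]. *)
Lemma weight_cross_ge0 X (rho nu : R -> R) : 0 <= X -> (X%:E < L)%E ->
  bmi X rho -> bmi X nu -> (forall t, 0 <= rho t) -> (forall t, 0 <= nu t) ->
  0 <= J X rho * J X (fun t => nu t * t ^+ 2) + J X nu * J X (fun t => rho t * t ^+ 2)
       - 2 * J X (fun t => rho t * t) * J X (fun t => nu t * t).
Proof.
move=> X0 XL hr hn r0 n0.
have fin := string_fin XL; have mD := itv_measurable X.
have hid : bmi X (fun t => t) := bmfun_id X.
set f := J X rho; set m1 := J X (fun t => rho t * t); set m2 := J X (fun t => rho t * t ^+ 2).
have pt y : 0 <= f * y ^+ 2 - 2 * m1 * y + m2.
  have -> : f * y ^+ 2 - 2 * m1 * y + m2 = J X (fun t => rho t * (y - t) ^+ 2).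
    transitivity (y ^+ 2 * f - (2 * y) * m1 + m2); first by ring.
    rewrite -!bmintZ; [|bmside..].
    rewrite -bmintB; [|bmside..]; rewrite -bmintD; [|bmside..].
    by apply: eq_Rintegral => t _; ring.
  by apply: Rintegral_ge0 => t _; rewrite mulr_ge0 ?sqr_ge0.
have -> : f * J X (fun t => nu t * t ^+ 2) + J X nu * m2 - 2 * m1 * J X (fun t => nu t * t)
    = J X (fun t => nu t * (f * t ^+ 2 - 2 * m1 * t + m2)).
  transitivity (f * J X (fun t => nu t * t ^+ 2) - (2 * m1) * J X (fun t => nu t * t)
    + m2 * J X nu); first by ring.
  move: f m1 m2 {pt} => f m1 m2.
  rewrite -!bmintZ; [|bmside..].
  rewrite -bmintB; [|bmside..]; rewrite -bmintD; [|bmside..].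
  by apply: eq_Rintegral => t _; ring.
by apply: Rintegral_ge0 => t _; rewrite mulr_ge0.
Qed.

Lemma weight_delta_le X (rho sigma : R -> R) : 0 <= X -> (X%:E < L)%E ->
  bmi X rho -> bmi X sigma -> (forall t, 0 <= rho t <= sigma t) ->
  weight_delta X rho <= weight_delta X sigma.
Proof.
move=> X0 XL hr hs rs.
have fin := string_fin XL; have mD := itv_measurable X.
have hid : bmi X (fun t => t) := bmfun_id X.
have [nu nuE] : exists nu : R -> R, nu = fun t => sigma t - rho t by exists (fun t => sigma t - rho t).
have hn : bmi X nu by rewrite nuE; bmt.
have r0 t : 0 <= rho t by case/andP: (rs t).
have n0 t : 0 <= nu t by rewrite nuE subr_ge0; case/andP: (rs t).
have Es (k : R -> R) : bmi X k -> J X (fun t => sigma t * k t) =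
    J X (fun t => rho t * k t) + J X (fun t => nu t * k t).
  move=> hk; rewrite -bmintD; [|bmside..].
  by apply: eq_Rintegral => t _; rewrite nuE; ring.
have E0 : J X sigma = J X rho + J X nu.
  by rewrite -bmintD; [|bmside..]; apply: eq_Rintegral => t _; rewrite nuE; ring.
have E2 := Es (fun t => t ^+ 2) ltac:(by bmt).
have E1 := Es (fun t => t) hid.
have c1 := weight_cross_ge0 X0 XL hr hn r0 n0.
have c2 := weight_cross_ge0 X0 XL hn hn n0 n0.
by move: c1 c2; rewrite /weight_delta E0 E1 E2; nra.
Qed.

Lemma Rintegral_restrict_lt (X s : R) (f : R -> R) : s <= X ->
  \int[m]_(t in `[0, s[) f t = J X (fun t => (t < s)%R%:R * f t).
Proof.
move=> sX; rewrite Rintegral_mkcond [RHS]Rintegral_mkcond.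
apply: eq_Rintegral => t _; rewrite !patchE !mem_setE !in_itv/=.
have [ts|st] := ltP t s; first by rewrite (ltW (lt_le_trans ts sX)) mul1r.
by rewrite andbF mul0r; case: ifP.
Qed.

Lemma delta_weight (X s : R) : s <= X -> delta s = weight_delta X (fun t => (t < s)%R%:R).
Proof.
move=> sX; rewrite /Defs.delta !(Rintegral_restrict_lt _ sX) /weight_delta mulrC.
by congr (_ * _ - _); apply: eq_Rintegral => t _; rewrite mulr1.
Qed.

Lemma delta_nondecreasing s t : s <= t -> 0 <= t -> (t%:E < L)%E -> delta s <= delta t.
Proof.
move=> st t0 tL; rewrite (delta_weight st) (delta_weight (lexx t)).
have mD := itv_measurable t.
apply: weight_delta_le => //; [exact: bmfun_lt|exact: bmfun_lt|move=> x].
rewrite ler0n ler_nat; have [xs|//] := ltP x s.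
by rewrite (lt_le_trans xs st).
Qed.

(** Bounded convergence; it yields the one-sided limits of [delta]. *)
Lemma bmint_cvg X (g_ : nat -> R -> R) (g : R -> R) (K : R) : (X%:E < L)%E ->
  (forall n, bmi X (g_ n)) -> bmi X g ->
  (forall n t, 0 <= t <= X -> `|g_ n t| <= K) ->
  (forall t, 0 <= t <= X -> g_ n t @[n --> \oo] --> g t) ->
  J X (g_ n) @[n --> \oo] --> J X g.
Proof.
move=> XL hg_ hg gK gg.
have fin := string_fin XL; have mD := itv_measurable X.
apply: fine_cvg; rewrite fineK; last first.
  by apply: integrable_fin_num => //; exact: bmfun_integrable.
apply: (@dominated_cvg _ _ _ m _ mD (fun n t => (g_ n t)%:E) (EFin \o g) (fun=> K%:E)).
- by move=> n; apply/measurable_EFinP; case: (hg_ n).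
- move=> t; rewrite /= in_itv/= => tX; apply: cvg_EFin; last exact: gg.
  exact: nearW.
- by [].
- by apply: (bmfun_integrable mD fin (bmfun_cst _ K)).
- by move=> n t; rewrite /= in_itv/= => tX; rewrite lee_fin gK.
Qed.

Lemma Rintegral_lt_cvg_left (X t : R) (f : R -> R) : (X%:E < L)%E -> bmi X f ->
  J X (fun x => (x < s)%R%:R * f x) @[s --> t^'-] --> J X (fun x => (x < t)%R%:R * f x).
Proof.
move=> XL hf; have mD := itv_measurable X; have [_ [K hK]] := hf.
have hlt s : bmi X (fun x : R => (x < s)%R%:R : R) by exact: bmfun_lt.
apply/cvg_at_leftP => u [ut cu].
apply: (@bmint_cvg _ _ _ K XL) => [n||n x xX|x xX]; [by bmt|by bmt|..].
  have xD : `[0, X]%classic x by rewrite /= in_itv.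
  have Kx := hK _ xD; have K0 := le_trans (normr_ge0 _) Kx.
  by case: (x < u n); rewrite ?mul1r// mul0r normr0.
have [xt|tx] := ltP x t.
  apply: (@cvg_near_eq _ _ _ _ _ (fun=> 1 * f x)); last exact: cvg_cst.
  by apply: filterS (cvgr_gt t cu _ xt) => n ->.
apply: (@cvg_near_eq _ _ _ _ _ (fun=> 0 * f x)); last exact: cvg_cst.
by apply: nearW => n; rewrite ltNge (ltW (lt_le_trans (ut n) tx)).
Qed.

Lemma Rintegral_lt_cvg_right (X t : R) (f : R -> R) : (X%:E < L)%E -> bmi X f ->
  J X (fun x => (x < s)%R%:R * f x) @[s --> t^'+] --> J X (fun x => (x <= t)%R%:R * f x).
Proof.
move=> XL hf; have mD := itv_measurable X; have [_ [K hK]] := hf.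
have hlt s : bmi X (fun x : R => (x < s)%R%:R : R) by exact: bmfun_lt.
have hle s : bmi X (fun x : R => (x <= s)%R%:R : R) by exact: bmfun_le.
apply/cvg_at_rightP => u [ut cu].
apply: (@bmint_cvg _ _ _ K XL) => [n||n x xX|x xX]; [by bmt|by bmt|..].
  have xD : `[0, X]%classic x by rewrite /= in_itv.
  have Kx := hK _ xD; have K0 := le_trans (normr_ge0 _) Kx.
  by case: (x < u n); rewrite ?mul1r// mul0r normr0.
have [xt|tx] := leP x t.
  apply: (@cvg_near_eq _ _ _ _ _ (fun=> 1 * f x)); last exact: cvg_cst.
  by apply: nearW => n; rewrite (le_lt_trans xt (ut n)).
apply: (@cvg_near_eq _ _ _ _ _ (fun=> 0 * f x)); last exact: cvg_cst.
by apply: filterS (cvgr_lt t cu _ tx) => n un; rewrite ltNge (ltW un).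
Qed.

Lemma delta_cvg_left t : 0 <= t -> (t%:E < L)%E -> delta s @[s --> t^'-] --> delta t.
Proof.
move=> t0 tL; have hid : bmi t (fun x => x) := bmfun_id t.
have h0 := Rintegral_lt_cvg_left (t := t) tL (bmfun_cst _ 1).
have h1 := Rintegral_lt_cvg_left (t := t) tL hid.
have h2 := Rintegral_lt_cvg_left (t := t) tL (bmfunX 2 hid).
apply: (@cvg_near_eq _ _ _ _ _ (fun s =>
    J t (fun x => (x < s)%R%:R * x ^+ 2) * J t (fun x => (x < s)%R%:R * 1)
    - J t (fun x => (x < s)%R%:R * x) * J t (fun x => (x < s)%R%:R * x))).
  near=> s; have st : s <= t by apply: ltW; near: s; exact: nbhs_left_lt.
  by rewrite /Defs.delta !(Rintegral_restrict_lt _ st) expr2.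
rewrite /Defs.delta !(Rintegral_restrict_lt _ (lexx t)) expr2.
by apply: cvgB; apply: cvgM.
Unshelve. all: by end_near. Qed.

Lemma delta_cvg_right t : 0 <= t -> (t%:E < L)%E ->
  delta s @[s --> t^'+] --> weight_delta t (fun=> 1).
Proof.
move=> t0 tL.
have [X tX XL] : exists2 X, t < X & (X%:E < L)%E.
  have [X [? ? ?]] := @filter_ex _ _ (string_end_proper S) _ (near_string_end tL).
  by exists X.
have hid : bmi X (fun x => x) := bmfun_id X.
have h0 := Rintegral_lt_cvg_right (t := t) XL (bmfun_cst _ 1).
have h1 := Rintegral_lt_cvg_right (t := t) XL hid.
have h2 := Rintegral_lt_cvg_right (t := t) XL (bmfunX 2 hid).
apply: (@cvg_near_eq _ _ _ _ _ (fun s =>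
    J X (fun x => (x < s)%R%:R * 1) * J X (fun x => (x < s)%R%:R * x ^+ 2)
    - J X (fun x => (x < s)%R%:R * x) * J X (fun x => (x < s)%R%:R * x))).
  near=> s; have sX : s <= X by apply: ltW; near: s; exact: nbhs_right_lt.
  by rewrite /Defs.delta !(Rintegral_restrict_lt _ sX) expr2 mulrC.
have -> : weight_delta t (fun=> 1) =
    J X (fun x => (x <= t)%R%:R * 1) * J X (fun x => (x <= t)%R%:R * x ^+ 2)
    - J X (fun x => (x <= t)%R%:R * x) * J X (fun x => (x <= t)%R%:R * x).
  rewrite /weight_delta !(Rintegral_restrict S _ (ltW tX)) -expr2.
  by congr (_ * _ - _ ^+ 2); apply: eq_Rintegral => x _; rewrite mul1r.
by apply: cvgB; apply: cvgM.
Unshelve. all: by end_near. Qed.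

(** The density of the mass on [[0, t[] plus the fraction [theta] of the mass at
    [t]. *)
Definition cut_weight (t theta : R) (x : R) : R :=
  (x < t)%R%:R + theta * (x == t)%R%:R.

Lemma bmfun_cut_weight X t theta : bmi X (cut_weight t theta).
Proof.
apply: bmfunD; first by apply: bmfun_lt; exact: itv_measurable.
apply: bmfunM; first exact: bmfun_cst.
apply: (@bmfun_bool _ (measurableTypeR R)).
by apply: measurable_fun_eqr; [exact: measurable_id|exact: measurable_cst].
Qed.

Lemma cut_weight_int X t theta (f : R -> R) : 0 <= t -> t <= X -> (X%:E < L)%E -> bmi X f ->
  J X (fun x => cut_weight t theta x * f x) =
  \int[m]_(x in `[0, t[) f x + theta * (fine (m [set t]) * f t).
Proof.
move=> t0 tX XL hf.
have fin := string_fin XL; have mD := itv_measurable X.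
have hlt : bmi X (fun x : R => (x < t)%R%:R : R) by exact: bmfun_lt.
have heq : bmi X (fun x : R => (x == t)%R%:R : R).
  apply: (@bmfun_bool _ (measurableTypeR R)).
  by apply: measurable_fun_eqr; [exact: measurable_id|exact: measurable_cst].
have -> : fine (m [set t]) * f t = J X (fun x => (x == t)%R%:R * f x).
  rewrite mulrC -(Rintegral_cst m (measurable_set1 (t : measurableTypeR R))).
  rewrite Rintegral_mkcond [RHS]Rintegral_mkcond; apply: eq_Rintegral => x _.
  have xtE : (x \in [set t]) = (x == t) by apply/idP/eqP; rewrite inE.
  rewrite !patchE xtE mem_setE in_itv/=.
  have [->|xt] := eqVneq x t; first by rewrite t0 tX mul1r.
  by rewrite mul0r; case: ifP.
rewrite (Rintegral_restrict_lt f tX) -bmintZ; [|bmside..].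
rewrite -bmintD; [|bmside..].
by apply: eq_Rintegral => x _; rewrite /cut_weight; ring.
Qed.

Lemma cut_weight_mass X t theta : 0 <= t -> t <= X -> (X%:E < L)%E ->
  J X (cut_weight t theta) = fine (m `[0, t[%classic) + fine (m [set t]) * theta.
Proof.
move=> t0 tX XL; have := cut_weight_int theta t0 tX XL (bmfun_cst _ 1).
rewrite Rintegral_cst ?mul1r ?mulr1; last exact: measurable_itv.
rewrite [X in _ = _ + X]mulrC => <-.
by apply: eq_Rintegral => x _; rewrite mulr1.
Qed.

Lemma cut_weight01 t theta x : 0 <= theta <= 1 -> 0 <= cut_weight t theta x <= 1.
Proof.
move=> /andP[th0 th1]; rewrite /cut_weight.
by case: (ltgtP x t) => _; rewrite ?mulr0 ?mulr1 ?addr0 ?add0r ?lexx ?ler01 ?th0.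
Qed.

Lemma cut_weight_lt t theta x : x < t -> cut_weight t theta x = 1.
Proof. by move=> xt; rewrite /cut_weight xt lt_eqF// mulr0 addr0. Qed.

Lemma cut_weight_gt t theta x : t < x -> cut_weight t theta x = 0.
Proof. by move=> tx; rewrite /cut_weight ltNge (ltW tx) gt_eqF// mulr0 addr0. Qed.

(** The determinant is affine in a point mass placed at [t], because the terms
    quadratic in that mass cancel. *)
Lemma cut_weight_delta X t theta : 0 <= t -> t <= X -> (X%:E < L)%E ->
  weight_delta X (cut_weight t theta) =
  delta t + theta * (weight_delta t (fun=> 1) - delta t).
Proof.
move=> t0 tX XL; have tL : (t%:E < L)%E by apply: le_lt_trans XL; rewrite lee_fin.
have E Y th : t <= Y -> (Y%:E < L)%E -> weight_delta Y (cut_weight t th) =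
    (\int[m]_(x in `[0, t[) 1 + th * (fine (m [set t]) * 1)) *
    (\int[m]_(x in `[0, t[) x ^+ 2 + th * (fine (m [set t]) * t ^+ 2))
    - (\int[m]_(x in `[0, t[) x + th * (fine (m [set t]) * t)) ^+ 2.
  move=> tY YL; have hid : bmi Y (fun x => x) := bmfun_id Y.
  rewrite -!(cut_weight_int th t0 tY YL)//; [|exact: bmfunX|exact: bmfun_cst].
  by congr (_ * _ - _); apply: eq_Rintegral => x _; rewrite mulr1.
have -> : weight_delta t (fun=> 1) = weight_delta t (cut_weight t 1).
  have e x : `[0, t]%classic x -> cut_weight t 1 x = 1.
    rewrite /= in_itv/= /cut_weight => /andP[_]; rewrite le_eqVlt mul1r.
    have [->|xt] := eqVneq x t; first by rewrite ltxx add0r.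
    by move=> /= ->; rewrite addr0.
  rewrite /weight_delta; congr (_ * _ - _ ^+ 2); apply: eq_Rintegral => x;
    by rewrite inE => /e ->.
rewrite !E//; rewrite /Defs.delta; ring.
Qed.

(** At [t = tau_hat r] the function [delta] is left continuous and at most [1 / r^2],
    while its right limit, which includes the mass at [t], is at least [1 / r^2].
    By [cut_weight_delta] some fraction [theta] of the mass at [t] makes the
    determinant equal to [1 / r^2]; [f_hat] interpolates with this very fraction, so
    it is the total mass of the cut measure. *)
Lemma f_hat_cut_weight r : 0 < r -> tau_set S r !=set0 ->
  exists t theta, [/\ 0 <= t, (t%:E < L)%E, 0 <= theta <= 1 &
    forall X, t <= X -> (X%:E < L)%E ->
      f_hat S r = J X (cut_weight t theta) /\
      weight_delta X (cut_weight t theta) = 1 / r ^+ 2].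
Proof.
move=> r0 [t1 tau_t1].
have lb : (0 <= tau_hat S r)%E.
  by apply/ereal_infP => _ [t [t0 _ _] <-]; rewrite lee_fin ltW.
have ub : (tau_hat S r <= t1%:E)%E by apply: ereal_inf_lbound; exists t1.
case Et : (tau_hat S r) lb ub => [t| |]//; rewrite !lee_fin => t0 tt1.
have t1L : (t1%:E < L)%E by case: tau_t1.
have tL : (t%:E < L)%E by apply: le_lt_trans t1L; rewrite lee_fin.
have below s : tau_set S r s -> t <= s.
  by move=> hs; rewrite -lee_fin -Et; apply: ereal_inf_lbound; exists s.
set c := 1 / r ^+ 2.
have c0 : 0 < c by rewrite divr_gt0// exprn_gt0.
have dl : delta t <= c.
  move: t0; rewrite le_eqVlt => /predU1P[<-|t0].
    by rewrite /Defs.delta set_itvxx !Rintegral_set0 mul0r expr0n subrr ltW.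
  apply: (@cvgr_to_le _ (t^'-) _ _ (fun s => delta s)).
    by apply: delta_cvg_left => //; exact: ltW.
  near=> s; rewrite leNgt; apply/negP => cs.
  have st : s < t by near: s; exact: nbhs_left_lt.
  suff : t <= s by rewrite leNgt st.
  apply: below; split; last exact: ltW.
    by near: s; exact: nbhs_left_gt.
  by apply: lt_trans tL; rewrite lte_fin.
set D1 := weight_delta t (fun=> 1).
have dr : c <= D1.
  apply: (@cvgr_to_ge _ (t^'+) _ _ (fun s => delta s)); first exact: delta_cvg_right.
  have [X tX XL] : exists2 X, t < X & (X%:E < L)%E.
    have [X [? ? ?]] := @filter_ex _ _ (string_end_proper S) _ (near_string_end tL).
    by exists X.
  near=> s.
  have ts : t < s by near: s; exact: nbhs_right_gt.
  have sX : s < X by near: s; exact: nbhs_right_lt.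
  have : (tau_hat S r < s%:E)%E by rewrite Et lte_fin.
  move=> /ereal_inf_ltP[_ [u [u0 uL cu] <-]]; rewrite lte_fin => us.
  apply: le_trans cu _; apply: delta_nondecreasing; [exact: ltW|exact: le_trans (ltW ts)|].
  by apply: lt_trans XL; rewrite lte_fin.
have fE : f_hat S r =
   if pselect (delta s @[s --> t] --> delta t) then fine (m `[0, t[%classic)
      else fine (m `[0, t[%classic)
           + fine (m [set t]) * ((c - delta t) / (delta_right S t - delta t)).
  by rewrite /f_hat Et.
have cutE X th := @cut_weight_mass X t th t0.
move: fE; case: pselect => [cont|ncont] fE.
- exists t, 0; split=> //; first by rewrite lexx ler01.
  move=> X tX XL; split; first by rewrite fE cutE// mulr0 addr0.
  rewrite cut_weight_delta// mul0r addr0; apply/le_anti; rewrite dl/=.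
  have [_ cr] := (left_right_continuousP _ _).2 cont.
  have <- : D1 = delta t by apply: cvg_unique (delta_cvg_right t0 tL) cr.
  by [].
have dD : delta t < D1.
  rewrite lt_neqAle (le_trans dl dr) andbT; apply/eqP => dD; refine (ncont _).
  apply/left_right_continuousP; split; first exact: delta_cvg_left.
  by rewrite dD; exact: delta_cvg_right.
have dR : delta_right S t = D1 by apply: cvg_lim => //; exact: delta_cvg_right.
exists t, ((c - delta t) / (D1 - delta t)); split=> //.
  have h : 0 < D1 - delta t by rewrite subr_gt0.
  rewrite divr_ge0 ?subr_ge0 ?(ltW dD)//= ler_pdivrMr// mul1r.
  by rewrite lerD2r.
move=> X tX XL; split; first by rewrite fE cutE// dR.
by rewrite cut_weight_delta// divfK ?subr_eq0 ?gt_eqF//; ring.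
Unshelve. all: by end_near. Qed.

End Truncation.

(** * Exhaustion of the string *)

Section Exhaustion.
Variables (R : realType) (S : krein_string R).
Local Notation m := (smass S).
Local Notation L := (slen S).

Lemma string_exhaustion : exists X : nat -> R,
  [/\ forall n, 0 < X n, forall n, ((X n)%:E < L)%E,
      {homo X : k n / (k <= n)%N >-> k <= n} &
      forall x, 0 <= x -> (x%:E < L)%E -> exists n, x < X n].
Proof.
have := slen_gt0 S; case: (slen S) => [l|_|//].
  rewrite lte_fin => l0; exists (fun n => l - l / n.+2%:R); split.
  - move=> n; rewrite subr_gt0 ltr_pdivrMr// ltr_pMr//.
    by rewrite ltr1n.
  - by move=> n; rewrite lte_fin gtrBl divr_gt0.
  - move=> k n kn; rewrite lerD2l lerN2 ler_pM2l// lef_pV2 ?posrE//.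
    by rewrite ler_nat.
  - move=> x x0; rewrite lte_fin => xl.
    have d0 : 0 < l - x by rewrite subr_gt0.
    have [n] := ltr_add_invr (divr_gt0 d0 l0).
    rewrite add0r ltr_pdivlMr// => hn.
    exists n; suff : l / n.+2%:R < l - x by rewrite ltrBrDl -ltrBrDr.
    apply: le_lt_trans hn; rewrite mulrC ler_pM2r// lef_pV2 ?posrE//.
    by rewrite ler_nat.
exists (fun n => n.+1%:R); split=> //.
- by move=> n; exact: ltry.
- by move=> k n kn; rewrite ler_nat.
- move=> x x0 _; exists (Num.truncn x).
  exact: truncnS_gt.
Qed.

Lemma string_range_measurable :
  measurable ([set x : R | 0 <= x /\ (x%:E < L)%E] : set (measurableTypeR R)).
Proof.
have := slen_gt0 S; case: (slen S) => [l _|_|//].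
  rewrite (_ : mkset _ = `[0, l[%classic); first exact: measurable_itv.
  by apply/seteqP; split=> x /=; rewrite in_itv/= lte_fin => /andP.
rewrite (_ : mkset _ = `[0, +oo[%classic); first exact: measurable_itv.
by apply/seteqP; split=> x /=; rewrite in_itv/= andbT ?ltry => // -[].
Qed.

Lemma mass_exhaustion (X : nat -> R) :
  {homo X : k n / (k <= n)%N >-> k <= n} ->
  (forall x, 0 <= x -> (x%:E < L)%E -> exists n, x < X n) ->
  m `[0, X n[%classic @[n --> \oo] --> m `[0, +oo[%classic.
Proof.
move=> Xhomo Xex.
have F_nd : nondecreasing_seq (fun n => `[0, X n[%classic : set (measurableTypeR R)).
  move=> k n kn; apply/subsetPset; apply: subset_itvl.
  by rewrite bnd_simp Xhomo.
have mF n : measurable (`[0, X n[%classic : set (measurableTypeR R)) by exact: measurable_itv.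
have -> : m `[0, +oo[%classic = m (\bigcup_n (`[0, X n[%classic : set (measurableTypeR R))).
  set U := \bigcup_n _.
  have mU : measurable U by exact: bigcupT_measurable.
  have mI : measurable (`[0, +oo[%classic : set (measurableTypeR R)) by exact: measurable_itv.
  have UI : U `<=` `[0, +oo[%classic.
    by move=> x [n _]; rewrite /= !in_itv/= => /andP[->].
  have mD : measurable (`[0, +oo[%classic `\` U) by exact: measurableD.
  rewrite -(setDUK UI) measureU//; last by rewrite setDIK.
  rewrite [X in (_ + X)%E](_ : _ = 0%E) ?adde0//.
  apply/eqP; rewrite eq_le measure_ge0 andbT.
  have Dsub : (`[0, +oo[%classic `\` U) `<=` [set x : R | ~ (0 <= x /\ (x%:E < L)%E)].
    move=> x [_ nU] [x0 xL]; apply: nU; have [n xn] := Xex x x0 xL.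
    by exists n => //=; rewrite in_itv/= x0.
  have mB : measurable ([set x : R | ~ (0 <= x /\ (x%:E < L)%E)] : set (measurableTypeR R)).
    exact: measurableC string_range_measurable.
  by rewrite -(smass_supp S) le_measure ?inE.
by apply: nondecreasing_cvg_mu => //; exact: bigcupT_measurable.
Qed.

Lemma mass_half_line : m `[0, +oo[%classic = m setT.
Proof.
have mI : measurable (`[0, +oo[%classic : set (measurableTypeR R)) by exact: measurable_itv.
have mB : measurable ([set x : R | ~ (0 <= x /\ (x%:E < L)%E)] : set (measurableTypeR R)).
  exact: measurableC string_range_measurable.
have mC : measurable (~` `[0, +oo[%classic : set (measurableTypeR R)) by exact: measurableC.
rewrite -(setUv (`[0, +oo[%classic : set (measurableTypeR R))) measureU//; last exact: setICr.
rewrite [X in (_ + X)%E](_ : _ = 0%E) ?adde0//.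
apply/eqP; rewrite eq_le measure_ge0 andbT -(smass_supp S) le_measure ?inE//.
by move=> x /= nx [x0 _]; apply: nx; rewrite in_itv/= x0.
Qed.

Lemma mass_positive : m setT <> 0%E ->
  exists x0, [/\ 0 <= x0, (x0%:E < L)%E & 0 < mass S x0].
Proof.
move=> m0; have [X [Xgt0 XL Xhomo Xex]] := string_exhaustion.
apply: contrapT => none; apply: m0; rewrite -mass_half_line.
have := mass_exhaustion Xhomo Xex.
rewrite (_ : (fun n => m `[0, X n[%classic) = fun=> 0%E).
  by move/cvg_lim => <-//; rewrite lim_cst.
apply/funext => n; apply/eqP; rewrite eq_le measure_ge0 andbT.
have Xfin := string_fin (XL n).
have mI : measurable (`[0, X n]%classic : set (measurableTypeR R)) by exact: measurable_itv.
have mass0 : mass S (X n) <= 0.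
  by rewrite leNgt; apply/negP => h; apply: none; exists (X n); split=> //; exact: ltW.
apply: (@le_trans _ _ (m `[0, X n]%classic)).
  apply: le_measure; rewrite ?inE//.
  by move=> x; rewrite /= !in_itv/= => /andP[-> /ltW].
have Ifin : m `[0, X n]%classic \is a fin_num by rewrite ge0_fin_numE.
rewrite -(fineK Ifin).
by move: mass0; rewrite /mass Rintegral_cst// mul1r lee_fin.
Qed.

End Exhaustion.

(** * The Titchmarsh-Weyl coefficient on the imaginary axis *)

Section Main.
Variables (R : realType) (S : krein_string R) (phi psi : R -> R[i] -> R[i]) (r : R).
Local Notation m := (smass S).
Local Notation L := (slen S).
Local Notation J X f := (\int[m]_(t in `[0%R, X]) f t).
Hypotheses (hsol : fundamental_solutions S phi psi) (r0 : 0 < r).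
Let z : R[i] := 0 +i* r.
Let phi1 t := complex.Re (phi t z).
Let phi2 t := complex.Im (phi t z).
Let psi1 t := complex.Re (psi t z).
Let psi2 t := complex.Im (psi t z).
Local Notation w1 := (weyl_re phi1 phi2 psi1 psi2).
Local Notation w2 := (weyl_im phi1 phi2 psi1 psi2).

Lemma fundamental_phi X : 0 <= X -> (X%:E < L)%E ->
  string_system m X r 1 0 0 phi1 phi2.
Proof.
move=> X0 XL; apply: string_solution_system => //; first exact: ltW.
have [+ _] := hsol z; congr (string_solution _ _ _ _).
by apply/funext => x; rewrite mul0r addr0.
Qed.

Lemma fundamental_psi X : 0 <= X -> (X%:E < L)%E ->
  string_system m X r 0 1 0 psi1 psi2.
Proof.
move=> X0 XL; apply: string_solution_system => //; first exact: ltW.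
have [_] := hsol z; congr (string_solution _ _ _ _).
by apply/funext => x; rewrite mul1r add0r.
Qed.

(** This also holds where [phi] vanishes, both sides being zero there. *)
Lemma weyl_quotient x : psi x z / phi x z = w1 x +i* w2 x.
Proof.
rewrite /weyl_re /weyl_im /phi_norm2 /phi1 /phi2 /psi1 /psi2.
by case: (psi x z) => a b; case: (phi x z) => c d /=; congr (_ +i* _); ring.
Qed.

Lemma weyl_im_cvg : m setT <> 0%E ->
  w2 x @[x --> string_end S] --> complex.Im (qS S phi psi z).
Proof.
move=> m0; have [x0 [x0_ge0 x0L Mx0]] := mass_positive m0.
have [c1 c2] := weyl_cvg r0 fundamental_phi fundamental_psi x0_ge0 x0L Mx0.
have h := cvg_lim (@norm_hausdorff _ _) (cvg_complex c1 c2).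
suff -> : qS S phi psi z = lim (w1 x @[x --> string_end S]) +i* lim (w2 x @[x --> string_end S]) by [].
by rewrite -h /qS; under eq_fun do rewrite weyl_quotient.
Qed.

Hypothesis m0 : m setT <> 0%E.
Local Notation q := (complex.Im (qS S phi psi z)).

Lemma near_weyl_dirichlet y : (y%:E < L)%E ->
  \forall X \near string_end S, [/\ y < X, 0 <= X, (X%:E < L)%E, 0 < mass S X &
    exists alpha a b, [/\ string_system m X r alpha (-1) (w2 X) a b, a X = 0 & b X = 0]].
Proof.
move=> yL; have [x0 [x0_ge0 x0L Mx0]] := mass_positive m0.
apply: filterS2 (near_string_end yL) (near_string_end x0L) => X [yX X0 XL] [x0X _ _].
have MX := mass_gt0 Mx0 (ltW x0X) XL.
have := weyl_dirichlet fundamental_phi fundamental_psi x0_ge0 Mx0 (ltW x0X) XL.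
by move=> [sys aX bX]; split=> //; do 3 eexists; split; [exact: sys|exact: aX|exact: bX].
Qed.

Lemma weyl_im_limit_ge0 : 0 <= q.
Proof.
apply: (cvgr_to_ge (weyl_im_cvg m0)).
apply: filterS (near_weyl_dirichlet (slen_gt0 S)) => X [_ X0 XL _ [al [a [b [sys aX bX]]]]].
exact: (dirichlet_ge0 X0 (string_fin XL) r0 sys aX bX).
Qed.

(** Pass to the limit in [dirichlet_upper]. *)
Lemma weyl_im_upper_cut t theta : 0 <= t -> (t%:E < L)%E -> 0 <= theta <= 1 ->
  (forall X, t <= X -> (X%:E < L)%E ->
    r ^+ 2 * weight_delta S X (cut_weight t theta) <= 1) ->
  q * (r * (fine (m `[0, t[%classic) + fine (m [set t]) * theta)) <= 4.
Proof.
move=> t0 tL th hd; set f := _ + _.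
apply: (@cvgr_to_le _ (string_end S) _ _ (fun X => w2 X * (r * f))).
  by apply: cvgM; [exact: weyl_im_cvg|exact: cvg_cst].
apply: filterS (near_weyl_dirichlet tL) => X [/ltW tX X0 XL _ [al [a [b [sys aX bX]]]]].
rewrite /f -(cut_weight_mass theta t0 tX XL).
apply: (dirichlet_upper X0 (string_fin XL) r0 sys aX bX).
- exact: bmfun_cut_weight.
- by move=> x; exact: cut_weight01.
- move=> x y hx yx; apply: cut_weight_lt; apply: lt_le_trans yx _.
  by rewrite leNgt; apply/negP => tx; move: hx; rewrite cut_weight_gt// ltxx.
- exact: hd.
Qed.

Lemma weyl_im_truncated : tau_set S r !=set0 ->
  1 / 2 * (1 / (r * f_hat S r)) <= q /\ q <= 4 * (1 / (r * f_hat S r)).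
Proof.
move=> tau0; have [t [theta [t0 tL th hX]]] := f_hat_cut_weight r0 tau0.
have [fE dE] := hX t (lexx t) tL.
have c0 : 0 < 1 / r ^+ 2 by rewrite divr_gt0// exprn_gt0.
have f0 : 0 < f_hat S r.
  rewrite lt_neqAle fE Rintegral_ge0 ?andbT; last by move=> x _; case/andP: (cut_weight01 t x th).
  apply/eqP => f0; move: c0; rewrite -dE /weight_delta -f0 mul0r add0r oppr_gt0.
  by rewrite ltNge sqr_ge0.
have rf : 0 < r * f_hat S r by rewrite mulr_gt0.
split; last first.
  rewrite mulrA mulr1 ler_pdivlMr// fE (cut_weight_mass theta t0 (lexx t) tL).
  apply: weyl_im_upper_cut => // X tX XL; have [_ ->] := hX X tX XL.
  by rewrite mulrA mulr1 divff// lt0r_neq0// exprn_gt0.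
rewrite mulrA mulr1 ler_pdivrMr//.
apply: (@cvgr_to_ge _ (string_end S) _ _ (fun X => w2 X * (r * f_hat S r))).
  by apply: cvgM; [exact: weyl_im_cvg|exact: cvg_cst].
apply: filterS (near_weyl_dirichlet tL) => X [/ltW tX X0 XL _ [al [a [b [sys aX bX]]]]].
have [fX dX] := hX X tX XL.
pose rho := cut_weight t theta.
have : 0 < weight_delta S X rho ->
    r <= w2 X * (r ^+ 2 * J X rho + J X rho / weight_delta S X rho) :=
  dirichlet_lower_truncated X0 (string_fin XL) r0 sys aX bX
  (bmfun_cut_weight X t theta) (fun x => cut_weight01 t x th)
  (fun x => @cut_weight_lt _ t theta x) (fun x => @cut_weight_gt _ t theta x).
rewrite /rho dX -fX => /(_ c0) h.
have E : r ^+ 2 * f_hat S r + f_hat S r / (1 / r ^+ 2) = r * (2 * (r * f_hat S r)).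
  by field; rewrite lt0r_neq0.
move: h; rewrite E mulrCA -[leLHS]mulr1 ler_pM2l//; lra.
Qed.

(** If [delta] stays below [1 / r^2], every truncation [[0, X n[] is admissible in the
    upper bound, and its mass tends to the total mass. If that is infinite, then
    [f_hat] is [0] by convention and the upper bound forces [Im q = 0]. For the lower
    bound the constant test function is used on ever longer intervals. *)
Lemma weyl_im_empty : ~ (tau_set S r !=set0) ->
  (L = +oo%E -> 1 / 2 * (1 / (r * f_hat S r)) <= q) /\ q <= 4 * (1 / (r * f_hat S r)).
Proof.
move=> tau0.
have tau_e : tau_set S r = set0.
  by apply/seteqP; split=> // x hx; apply: tau0; exists x.
have fE : f_hat S r = fine (m `[0, +oo[%classic).
  by rewrite /f_hat /tau_hat tau_e image_set0 ereal_inf0.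
have [X [Xgt0 XL Xhomo Xex]] := string_exhaustion S.
have cm := mass_exhaustion Xhomo Xex.
have upper n : q * (r * fine (m `[0, X n[%classic)) <= 4.
  have := @weyl_im_upper_cut (X n) 0 (ltW (Xgt0 n)) (XL n).
  rewrite lexx ler01 mulr0 addr0 => /(_ isT); apply=> Y XY YL.
  rewrite cut_weight_delta ?(ltW (Xgt0 n))// mul0r addr0.
  rewrite mulrC -ler_pdivlMr ?exprn_gt0// leNgt; apply/negP => h.
  by apply: tau0; exists (X n); split=> //; exact: ltW.
have q0 := weyl_im_limit_ge0.
have r_f0 : f_hat S r = 0 -> 1 / (r * f_hat S r) = 0 by move=> ->; rewrite mulr0 invr0 mulr0.
have fin n : m `[0, X n[%classic \is a fin_num.
  rewrite ge0_fin_numE//; apply: le_lt_trans (string_fin (XL n)).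
  apply: le_measure; rewrite ?inE//.
  by move=> x; rewrite /= !in_itv/= => /andP[-> /ltW].
have [minf|mfin] := eqVneq (m `[0, +oo[%classic) +oo%E.
  have f0 : f_hat S r = 0 by rewrite fE minf.
  rewrite r_f0// !mulr0; split=> //.
  rewrite leNgt; apply/negP => q_gt0.
  move: cm; rewrite minf => /cvgeyPgt => /(_ (4 / (q * r)))[N _ hN].
  have := hN N (leqnn N); rewrite -(fineK (fin N)) lte_fin ltr_pdivrMr ?mulr_gt0//.
  by rewrite mulrC -mulrA ltNge upper.
have mfin' : m `[0, +oo[%classic \is a fin_num by rewrite ge0_fin_numE// ltey.
have f0 : 0 < f_hat S r.
  rewrite fE fine_gt0// ltey mfin andbT lt_neqAle measure_ge0 andbT eq_sym.
  by rewrite (mass_half_line S); apply/eqP.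
have rf : 0 < r * f_hat S r by rewrite mulr_gt0.
split; last first.
  rewrite mulrA mulr1 ler_pdivlMr// fE.
  apply: (@cvgr_to_le _ \oo _ _ (fun n => q * (r * fine (m `[0, X n[%classic)))); last exact: nearW.
  apply: cvgM; first exact: cvg_cst.
  by apply: cvgM; [exact: cvg_cst|apply: fine_cvg; rewrite fineK].
move=> Loo; rewrite mulrA mulr1 ler_pdivrMr//.
apply: (@cvgr_to_ge _ (string_end S) _ _ (fun X => w2 X * (r * f_hat S r))).
  by apply: cvgM; [exact: weyl_im_cvg|exact: cvg_cst].
have [x0 [x0_ge0 x0L Mx0]] := mass_positive m0.
(* Beyond y the integral of Y - t is at least 1 / r, so that |g|^2 <= r^2 |1|^2. *)
pose y := x0 + 1 / (r * mass S x0).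
have yL : (y%:E < L)%E by rewrite Loo ltry.
apply: filterS (near_weyl_dirichlet yL) => Y [yY Y0 YL MY [al [a [b [sys aX bX]]]]].
have x0Y : x0 <= Y.
  by apply: ltW; apply: le_lt_trans yY; rewrite lerDl divr_ge0// mulr_ge0 ?ltW.
have finY := string_fin YL; have mD := itv_measurable Y.
have hid : bmfun (`[0, Y]%classic : set (measurableTypeR R)) (fun t => t) := bmfun_id Y.
pose l := J Y (fun t => Y - t).
have hl : 1 / r <= l.
  apply: (@le_trans _ _ ((Y - x0) * mass S x0)).
    rewrite -ler_pdivrMr// lerBrDl; apply: le_trans (ltW yY).
    by rewrite /y lerD2l -mulrA -invfM.
  rewrite /mass (Rintegral_restrict S _ x0Y).
  have hle : bmfun (`[0, Y]%classic : set (measurableTypeR R)) (fun t : R => (t <= x0)%R%:R : R).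
    exact: bmfun_le.
  rewrite -bmintZ; [|bmside..].
  apply: bmint_le; [exact: mD|exact: finY|by bmt|by bmt|move=> t].
  rewrite /= in_itv/= => /andP[_ tY].
  case: (leP t x0) => tx; first by rewrite mulr1 mulr1 lerD2l lerN2.
  by rewrite mul0r mulr0 subr_ge0.
have l0 : 0 < l by apply: lt_le_trans hl; rewrite divr_gt0.
have := dirichlet_lower_constant Y0 finY r0 sys aX bX l0.
rewrite -/(mass S Y) -/l => h.
have g0 := dirichlet_ge0 Y0 finY r0 sys aX bX.
have Mf : mass S Y <= f_hat S r.
  rewrite fE /mass Rintegral_cst ?mul1r//; apply: fine_le => //.
    by rewrite ge0_fin_numE.
  apply: le_measure; rewrite ?inE//.
  by move=> x; rewrite /= !in_itv/= => /andP[->].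
have lr : mass S Y / l ^+ 2 <= r ^+ 2 * mass S Y.
  rewrite mulrC ler_pM2r// -[leRHS]invrK lef_pV2 ?posrE ?invr_gt0 ?exprn_gt0//.
  rewrite -exprVn -div1r ler_sqr ?nnegrE ?(ltW l0)//.
  by rewrite divr_ge0// ltW.
have h2 : r <= w2 Y * (r * (2 * (r * f_hat S r))).
  apply: le_trans h _; rewrite ler_wpM2l//.
  by have := ler_wpM2l (sqr_ge0 r) Mf; lra.
move: h2; rewrite mulrCA -[leLHS]mulr1 ler_pM2l//; lra.
Qed.

End Main.

Theorem theorem6p1 (R : realType) :
  exists C1 C2 : R, [/\ 0 < C1, 0 < C2 &
    forall (S : krein_string R) (phi psi : R -> R[i] -> R[i]),
      fundamental_solutions S phi psi ->
      smass S setT <> 0%E ->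
      forall r : R, 0 < r ->
        (slen S = +oo%E \/ tau_set S r !=set0 ->
           C1 * (1 / (r * f_hat S r)) <= complex.Im (qS S phi psi (0 +i* r)))
        /\ complex.Im (qS S phi psi (0 +i* r)) <= C2 * (1 / (r * f_hat S r))].
Proof.
exists (1 / 2), 4; split=> [||S phi psi hsol m0 r r0]; [by rewrite divr_gt0|by []|].
have [ne|e] := pselect (tau_set S r !=set0).
  by have [lo up] := weyl_im_truncated hsol r0 m0 ne.
have [lo up] := weyl_im_empty hsol r0 m0 e.
by split=> // -[/lo|/e].
Qed.
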